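(* Let $H\in\mathcal N_2$ be a normal affine semigroup in $\mathbb N^2$ with extremal rays $\mathbf a_i=(x_i,y_i)$ for $i=1,2$, and let $K$ be a field. Assume $(1,1)\in\omega_H$ and $x_1x_2y_1y_2\ne0$. Then $K[H]$ is AG (almost Gorenstein) if and only if $x_i\equiv1\bmod(x_i-y_i)$ for $i=1,2$.
   Context: $\mathbb N=\{0,1,2,\dots\}$. $\mathcal N_2$ is the class of normal affine semigroups $H\subseteq\mathbb N^2$ generating $\mathbb Z^2$ as a group: $H$ is a finitely generated submonoid of $\mathbb N^2$ with $H=C\cap\mathbb Z^2$, where $C\subseteq\mathbb R^2$ is the (two-dimensional) cone generated by $H$. The extremal rays of $H$ are the primitive lattice vectors $\mathbf a_1,\mathbf a_2\in H$ lying on the two extremal rays of $C$. Put $\omega_H=\mathbb Z^2\cap\operatorname{relint}C$. $R=K[H]$ is the subalgebra of the polynomial ring in two variables over $K$ spanned by the monomials $\mathbf x^{\mathbf h}$, $\mathbf h\in H$; its graded maximal ideal $\mathfrak m$ is generated by $\mathbf x^{\mathbf h}$, $0\ne\mathbf h\in H$. The canonical module $\omega_R$ is the ideal of $R$ spanned over $K$ by the monomials $\mathbf x^{\mathbf h}$, $\mathbf h\in\omega_H$. A graded Cohen–Macaulay $R$-module $E$ is Ulrich if its minimal number of generators equals its multiplicity $e(E)$ with respect to $\mathfrak m$; the zero module counts as Ulrich. An element $\mathbf b\in\omega_H$ is called an Ulrich element in $H$ if $\omega_R/\mathbf x^{\mathbf b}R$ is an Ulrich $R$-module. The ring $K[H]$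 is called AG (almost Gorenstein) if $H$ has an Ulrich element. *)

(* Defs.v *)
From HB Require Import structures.
From mathcomp Require Import all_boot all_order all_algebra.
From mathcomp Require Import mpoly.
From mathcomp Require Import boolp classical_sets reals topology normedtype.

Set Implicit Arguments.
Unset Strict Implicit.
Unset Printing Implicit Defensive.

Import Order.TTheory GRing.Theory Num.Theory numFieldNormedType.Exports.

Local Open Scope classical_set_scope.
Local Open Scope ring_scope.
Local Open Scope quotient_scope.

Section Convex.
Variables (R : realType) (n : nat).
Implicit Types (A C : set 'rV[R]_n) (v : 'rV[R]_n).

Definition affine_hull A : set 'rV[R]_n :=
  [set v | exists s : seq (R * 'rV[R]_n),
     [/\ {in s, forall p, A p.2}, \sum_(p <- s) p.1 = 1
       & v = \sum_(p <- s) p.1 *: p.2]].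

Definition relint A : set 'rV[R]_n :=
  [set v | A v /\ within (affine_hull A) (nbhs v) A].

Definition ray v : set 'rV[R]_n := [set t *: v | t in [set t | 0 <= t]].

(* Extremal means that the ray is a face of the cone C. *)
Definition spans_extremal_ray C v : Prop :=
  [/\ C v, v != 0
    & forall u w, C u -> C w -> ray v (u + w) -> ray v u /\ ray v w].

End Convex.

(* Elements of N^n are represented as exponent vectors 'X_{1..n}. *)
Record submonoid (n : nat) := Submonoid {
  submonoid_set :> 'X_{1..n} -> Prop;
  submonoid0 : submonoid_set 0%MM;
  submonoidD : forall g h,
    submonoid_set g -> submonoid_set h -> submonoid_set (g + h)%MM }.

Definition mnm_vec (S : pzSemiRingType) n (h : 'X_{1..n}) : 'rV[S]_n :=
  \row_i (h i)%:R.
Arguments mnm_vec S {n} h.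

Definition mnm2 (x y : nat) : 'X_{1..2} := [multinom [tuple x; y]].

Section Semigroups.
Variables (R : realType) (n : nat).
Implicit Type H : submonoid n.

Definition cone H : set 'rV[R]_n :=
  [set v | exists s : seq (R * 'X_{1..n}),
     {in s, forall p, 0 <= p.1 /\ H p.2} /\
     v = \sum_(p <- s) p.1 *: mnm_vec R p.2].

Definition finitely_generated H : Prop :=
  exists s : seq 'X_{1..n}, {in s, forall g, H g} /\
    forall h, H h -> exists c : 'X_{1..n} -> nat,
      h = \big[+%MM/0%MM]_(g <- s) (g *+ c g)%MM.

Definition generates_lattice H : Prop :=
  forall z : 'rV[int]_n, exists s : seq (int * 'X_{1..n}),
    {in s, forall p, H p.2} /\ z = \sum_(p <- s) p.1 *: mnm_vec int p.2.

(* For n = 2 this is membership in the class N_2. *)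
Definition normal_affine_semigroup H : Prop :=
  [/\ finitely_generated H, generates_lattice H
    & mnm_vec int @` [set h | H h] = [set z | cone H (map_mx intr z)]].

(* When H is normal, every point of Z^n in the relative interior of the cone
   lies in H, so that nothing is lost by restricting to N^n. *)
Definition semigroup_omega H : set 'X_{1..n} :=
  [set h | relint (cone H) (mnm_vec R h)].

Definition extremal_ray H (a : 'X_{1..n}) : Prop :=
  [/\ H a, \big[gcdn/0%N]_(i < n) a i = 1%N
    & spans_extremal_ray (cone H) (mnm_vec R a)].

End Semigroups.
Arguments cone R {n} H.
Arguments semigroup_omega R {n} H.
Arguments normal_affine_semigroup R {n} H.
Arguments extremal_ray R {n} H a.

Section SemigroupTheory.
Variables (R : realType) (n : nat) (H : submonoid n).

Lemma mnm_vecD (g h : 'X_{1..n}) :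
  mnm_vec R (g + h)%MM = mnm_vec R g + mnm_vec R h.
Proof. by apply/rowP => i; rewrite !mxE mnmDE natrD. Qed.

Lemma cone_mem h : H h -> cone R H (mnm_vec R h).
Proof.
move=> Hh; exists [:: (1, h)]; split; last by rewrite big_seq1 scale1r.
by move=> p; rewrite inE => /eqP ->.
Qed.

Lemma cone0 : cone R H 0.
Proof. by exists [::]; rewrite big_nil. Qed.

Lemma coneD u v : cone R H u -> cone R H v -> cone R H (u + v).
Proof.
case=> [s [sH ->]] [t [tH ->]]; exists (s ++ t); rewrite big_cat; split=> // p.
by rewrite mem_cat => /orP[/sH|/tH].
Qed.

Lemma affine_hullB (A : set 'rV[R]_n) v c :
  A 0 -> A c -> affine_hull A v -> affine_hull A (v - c).
Proof.
move=> A0 Ac [s [sA s1 ->]]; exists ((1, 0) :: (-1, c) :: s); split.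
- by move=> p; rewrite !inE => /or3P[/eqP->|/eqP->|/sA].
- by rewrite !big_cons s1 /= addrA subrr add0r.
- by rewrite !big_cons /= scaler0 add0r scaleN1r addrC.
Qed.

Lemma semigroup_omegaD g h :
  semigroup_omega R H g -> H h -> semigroup_omega R H (g + h)%MM.
Proof.
move=> [gC gN] Hh; have hC := cone_mem Hh.
rewrite /semigroup_omega /= mnm_vecD; split; first exact: coneD.
have gN' : \forall v \near mnm_vec R g, affine_hull (cone R H) v -> cone R H v.
  exact: gN.
suff : \forall v \near mnm_vec R g + mnm_vec R h,
    affine_hull (cone R H) v -> cone R H v by [].
apply/nbhs0P; move/nbhs0P: gN'; apply: filterS => e De aff.
have eE : mnm_vec R g + mnm_vec R h + e - mnm_vec R h = mnm_vec R g + e.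
  by rewrite addrAC addrK.
rewrite -[X in cone _ _ X](subrK (mnm_vec R h)) eE; apply: coneD => //.
by apply: De; rewrite -eE; apply: affine_hullB => //; exact: cone0.
Qed.

Lemma semigroup_omega_sub h : normal_affine_semigroup R H ->
  semigroup_omega R H h -> H h.
Proof.
case=> _ _ HC [hC _].
have [g Hg gh] : (mnm_vec int @` [set h | H h]) (mnm_vec int h).
  rewrite HC /=; congr (cone _ _ _): hC.
  by apply/rowP=> i; rewrite !mxE rmorph_nat.
suff <- : g = h by [].
apply/mnmP => i; move/rowP/(_ i): gh; rewrite !mxE.
by rewrite !natz => -[].
Qed.

End SemigroupTheory.

Section QuotientModule.
Variables (A : pzRingType) (V : lmodType A) (N : submodClosed V).

Definition submod_pred : {pred V} := N.
HB.instance Definition _ := GRing.isZmodClosed.Build V submod_pred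
  (GRing.submod_closedB (submodClosedP N)).

Definition quotmod := Quotient.quot submod_pred.
HB.instance Definition _ := GRing.Zmodule.on quotmod.

Definition quotmod_pi (v : V) : quotmod := \pi_(Quotient.quot submod_pred) v.

Lemma quotmod_piP (u v : V) : quotmod_pi u = quotmod_pi v <-> u - v \in N.
Proof.
change (u - v \in N) with (u - v \in submod_pred).
by rewrite Quotient.idealrBE; split=> [uv|/eqP]; first exact/eqP.
Qed.

Lemma quotmod_pi_repr (x : quotmod) : quotmod_pi (repr x) = x.
Proof. exact: reprK. Qed.

Lemma quotmod_piD : {morph quotmod_pi : u v / u + v}.
Proof. by move=> u v; rewrite /quotmod_pi piE. Qed.

Definition quotmod_scale (a : A) (x : quotmod) : quotmod :=
  quotmod_pi (a *: repr x).

Lemma quotmod_piZ a v : quotmod_pi (a *: v) = quotmod_scale a (quotmod_pi v).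
Proof.
apply/quotmod_piP; rewrite -scalerBr rpredZ //.
by apply/quotmod_piP; rewrite quotmod_pi_repr.
Qed.

Fact quotmod_scaleA a b x :
  quotmod_scale a (quotmod_scale b x) = quotmod_scale (a * b) x.
Proof. by rewrite -[x]quotmod_pi_repr -!quotmod_piZ scalerA. Qed.

Fact quotmod_scale1 : left_id 1 quotmod_scale.
Proof. by move=> x; rewrite -[x]quotmod_pi_repr -quotmod_piZ scale1r. Qed.

Fact quotmod_scaleDr : right_distributive quotmod_scale +%R.
Proof.
move=> a x y; rewrite -[x]quotmod_pi_repr -[y]quotmod_pi_repr.
by rewrite -quotmod_piD -!quotmod_piZ scalerDr quotmod_piD.
Qed.

Fact quotmod_scaleDl x : {morph quotmod_scale^~ x : a b / a + b}.
Proof.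
move=> a b; rewrite -[x]quotmod_pi_repr -!quotmod_piZ scalerDl.
exact: quotmod_piD.
Qed.

HB.instance Definition _ := GRing.Zmodule_isLmodule.Build A quotmod
  quotmod_scaleA quotmod_scale1 quotmod_scaleDr quotmod_scaleDl.

End QuotientModule.

Section ModuleInvariants.
Variables (A : comNzRingType) (m : set A) (E : lmodType A).

Definition is_max (P : nat -> Prop) (k : nat) : Prop :=
  P k /\ forall j, P j -> (j <= k)%N.

Definition is_min (P : nat -> Prop) (k : nat) : Prop :=
  P k /\ forall j, P j -> (k <= j)%N.

Definition annihilator : set A := [set a | forall u : E, a *: u = 0].

Definition krull_dim : nat -> Prop := is_max (fun k =>
  exists p : nat -> prime_idealr A,
    (forall a, annihilator a -> a \in p 0%N) /\
    forall i, (i < k)%N ->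
      {subset p i <= p i.+1} /\ ~ {subset p i.+1 <= p i}).

(* The length of E/N: submodules of E/N correspond to submodules of E
   containing N. *)
Definition quotient_length (N : set E) : nat -> Prop := is_max (fun k =>
  exists L : nat -> submodClosed E,
    (forall u, N u -> u \in L 0%N) /\
    forall i, (i < k)%N ->
      {subset L i <= L i.+1} /\ ~ {subset L i.+1 <= L i}).

Definition ideal_mul (N : set E) : set E :=
  [set u | exists s : seq (A * E),
     {in s, forall p, m p.1 /\ N p.2} /\ u = \sum_(p <- s) p.1 *: p.2].

Definition ideal_pow_mul (k : nat) : set E := iter k ideal_mul setT.

Definition seq_mul (r : seq A) : set E :=
  [set u | exists v : nat -> E, u = \sum_(i < size r) r`_i *: v i].

Definition regular_sequence (r : seq A) : Prop :=
  (forall i, (i < size r)%N -> forall u,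
     seq_mul (take i r) (r`_i *: u) -> seq_mul (take i r) u) /\
  exists u, ~ seq_mul r u.

Definition depth : nat -> Prop := is_max (fun k =>
  exists r : seq A,
    [/\ size r = k, {in r, forall a, m a} & regular_sequence r]).

(* For E finitely generated and graded over a *-local ring with *-maximal ideal
   m, this is equivalent to being Cohen-Macaulay at every prime, and depth and
   krull_dim are those of the localization at m. *)
Definition cohen_macaulay : Prop := exists2 d, krull_dim d & depth d.

Definition min_num_gens : nat -> Prop := is_min (fun k =>
  exists s : seq E, size s = k /\
    forall u, exists c : nat -> A, u = \sum_(i < size s) c i *: s`_i).

(* P is the Hilbert-Samuel polynomial of E with respect to m. *)
Definition multiplicity (e : nat) : Prop :=
  exists (d : nat) (P : {poly rat}),
    [/\ krull_dim d, size P = d.+1, lead_coef P = e%:R / d`!%:R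
      & exists k0, forall k, (k0 <= k)%N -> exists2 l,
          quotient_length (ideal_pow_mul k.+1) l & P.[k%:R] = l%:R].

(* The existence of k makes E finitely generated. *)
Definition ulrich : Prop :=
  (forall u : E, u = 0) \/
  cohen_macaulay /\ exists2 k, min_num_gens k & multiplicity k.

End ModuleInvariants.

Section SemigroupRing.
Variables (K : fieldType) (n : nat) (H : submonoid n).

Definition supported_in (S : 'X_{1..n} -> Prop) : {pred {mpoly K[n]}} :=
  fun f => `[< {in msupp f, forall h, S h} >].

Lemma supported_in0 S : 0 \in supported_in S.
Proof. by apply/asboolP => h; rewrite msupp0. Qed.

Lemma supported_inB S : {in supported_in S &, forall f g, f - g \in supported_in S}.
Proof.
move=> f g /asboolP fS /asboolP gS; apply/asboolP => h /msuppB_le.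
by rewrite mem_cat => /orP[/fS|/gS].
Qed.

Lemma supported_inD S : {in supported_in S &, forall f g, f + g \in supported_in S}.
Proof.
move=> f g /asboolP fS /asboolP gS; apply/asboolP => h /msuppD_le.
by rewrite mem_cat => /orP[/fS|/gS].
Qed.

Lemma supported_inM (S T U : 'X_{1..n} -> Prop) f g :
    (forall a b, S a -> T b -> U (a + b)%MM) ->
  f \in supported_in S -> g \in supported_in T -> f * g \in supported_in U.
Proof.
move=> STU /asboolP fS /asboolP gT; apply/asboolP => h.
by move=> /msuppM_le/allpairsP[[a b] /= [/fS Sa /gT Tb ->]]; exact: STU.
Qed.

Fact semigroup_ring_closed : subring_closed (supported_in H).
Proof.
split; last by move=> f g; apply: supported_inM; exact: submonoidD.
- by apply/asboolP => h; rewrite msupp1 inE => /eqP ->; exact: submonoid0.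
- exact: supported_inB.
Qed.

Definition in_semigroup_ring : {pred {mpoly K[n]}} := supported_in H.
HB.instance Definition _ := GRing.isSubringClosed.Build {mpoly K[n]}
  in_semigroup_ring semigroup_ring_closed.

Record semigroup_ring := SemigroupRing {
  sr_poly :> {mpoly K[n]};
  sr_polyP : sr_poly \in in_semigroup_ring }.
HB.instance Definition _ := [isSub for sr_poly].
HB.instance Definition _ := [Choice of semigroup_ring by <:].
HB.instance Definition _ := [SubChoice_isSubComNzRing of semigroup_ring by <:].

(* The ideal generated by the x^h, 0 <> h in H; the linear combination is
   written in the ambient polynomial ring, where 'X_[h] lives. *)
Definition graded_max_ideal : set semigroup_ring :=
  [set f | exists s : seq (semigroup_ring * 'X_{1..n}),
     {in s, forall p, H p.2 /\ p.2 != 0%MM} /\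
     sr_poly f = \sum_(p <- s) sr_poly p.1 * 'X_[p.2]].

End SemigroupRing.
Arguments graded_max_ideal : clear implicits.
Arguments graded_max_ideal K {n} H.
Arguments semigroup_ring K {n} H.

Section CanonicalModule.
Variables (R : realType) (K : fieldType) (n : nat) (H : submonoid n).
Local Notation KH := (semigroup_ring K H).

Definition in_canonical_module : {pred KH^o} :=
  fun f => sr_poly f \in supported_in (semigroup_omega R H).

Fact canonical_module_closed : submod_closed in_canonical_module.
Proof.
split; first exact: supported_in0.
move=> a f g fO gO; apply: supported_inD => //.
apply: supported_inM (sr_polyP a) fO => h k Hh kO.
by rewrite addmC; exact: semigroup_omegaD.
Qed.
HB.instance Definition _ := GRing.isSubmodClosed.Build KH KH^o
  in_canonical_module canonical_module_closed.

Record canonical_module := CanonicalModule {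
  cm_val :> KH^o;
  cm_valP : cm_val \in in_canonical_module }.
HB.instance Definition _ := [isSub for cm_val].
HB.instance Definition _ := [Choice of canonical_module by <:].
HB.instance Definition _ := [SubChoice_isSubLmodule of canonical_module by <:].

Section Quotient.
Variable b : 'X_{1..n}.

(* x^b R, as a submodule of omega_R; b is in omega_H wherever this is used,
   so that x^b is an element of R and x^b R is contained in omega_R. *)
Definition in_monomial_submodule : {pred canonical_module} :=
  fun f => `[< exists g : KH, sr_poly (cm_val f) = sr_poly g * 'X_[b] >].

Fact monomial_submodule_closed : submod_closed in_monomial_submodule.
Proof.
split; first by apply/asboolP; exists 0; rewrite mul0r.
move=> a f g /asboolP[p fp] /asboolP[q gq]; apply/asboolP; exists (a * p + q).
by rewrite /= mulrDl -mulrA -fp -gq.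
Qed.
HB.instance Definition _ := GRing.isSubmodClosed.Build KH canonical_module
  in_monomial_submodule monomial_submodule_closed.

Definition omega_quotient : lmodType KH := quotmod in_monomial_submodule.

End Quotient.

Definition ulrich_element (b : 'X_{1..n}) : Prop :=
  semigroup_omega R H b /\ ulrich (graded_max_ideal K H) (omega_quotient b).

Definition almost_gorenstein : Prop := exists b, ulrich_element b.

End CanonicalModule.
Arguments ulrich_element R K {n} H b.
Arguments almost_gorenstein R K {n} H.

(* Main.v *)
(* Let u and w be the linear forms vanishing on a_1 and a_2, positive on the cone,
   so that H = {u, w >= 0}, omega_H = {u, w >= 1}, and let d = u(a_2) = w(a_1).
   The points of omega_H outside b + H lie on the lines u = j, 0 < j < u(b), and
   w = j, 0 < j < w(b).  Those on u = j are p_j + n a_1, n >= 0, with p_j the one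
   such that 0 < w(p_j) <= d.  Hence omega_R / x^b R has multiplicity
   u(b) + w(b) - 2 and is generated by the same number of monomials p_j and q_j,
   so it is Ulrich only if none of these is redundant, that is, if w(p_j)
   decreases with j, and likewise u(q_j).  Modulo d, w(p_j) is j w(p_1); for a
   decreasing sequence this forces p_j = a_1 - j (a_1 - p_1).  As (1,1) is a
   minimal element of omega_H, it is p_j for j = u(1,1) = |x_1 - y_1|, so
   a_1 - (1,1) is divisible by x_1 - y_1.  Conversely, under the congruences the
   p_j and q_j for b = (1,1) lie on the segments from (1,1) to a_1 and a_2,
   and m^k (omega_R / x^b R) is spanned by the points with n >= k. *)

From HB Require Import structures.
Require Import Defs.
From mathcomp Require Import all_boot all_order all_algebra reals.
From mathcomp Require Import mpoly zify ring lra.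
From mathcomp Require Import boolp classical_sets topology normedtype.

Set Implicit Arguments.
Unset Strict Implicit.
Unset Printing Implicit Defensive.

(** * Monomials in the quotient of the canonical module *)

Section MonomialQuotient.
Import Order.TTheory GRing.Theory Num.Theory.
Local Open Scope ring_scope.

Variables (R : realType) (K : fieldType) (n : nat) (H : submonoid n).
Variable (b : 'X_{1..n}).
Local Notation KH := (semigroup_ring K H).
Local Notation Om := (semigroup_omega R H).
Local Notation E := (omega_quotient R K H b).
Local Notation mmax := (graded_max_ideal K H).

(** The Ulrich element [b] is arbitrary while the congruences concern [(1,1)], and the Ulrich
    property controls the points [p_j] only for [j < u(b)]. The case [u(b) < u(1,1)] has to be
    excluded separately, by looking at the other ray. For a general [b] the two families of points
    may overlap, and m^k may reach further in than expected. The length of E/m^k E is then only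
    enclosed between two linear functions of [k] with the same slope, which still determines the
    leading coefficient of the Hilbert-Samuel polynomial. The estimates are linear algebra over [K]:
    the monomials outside [b + H] form a basis of the quotient, chains of submodules are bounded
    above by the rank of a coefficient matrix and below by adding monomials one at a time. In the
    converse direction the quotient must also be shown Cohen-Macaulay, so Krull dimension and depth
    are both computed. Primes are compared with the ideals of the two faces of the cone, and depth
    at most 1 follows from the linear growth of the set of basis monomials. *)

Definition to_ring (f : {mpoly K[n]}) : KH := insubd 0 f.

Lemma to_ringK f : f \in supported_in H -> sr_poly (to_ring f) = f.
Proof. by move=> fH; rewrite /to_ring -[sr_poly _]/(val _) insubdK. Qed.

Lemma supported_inP (S : 'X_{1..n} -> Prop) (f : {mpoly K[n]}) :
  f \in supported_in S <-> forall h, h \in msupp f -> S h.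
Proof. by split=> [/asboolP|fS]; [|apply/asboolP]. Qed.

Lemma supported_inX (S : 'X_{1..n} -> Prop) h : S h -> 'X_[h] \in @supported_in K n S.
Proof. by move=> Sh; apply/asboolP => c; rewrite msuppX inE => /eqP ->. Qed.

Lemma supported_inZ (S : 'X_{1..n} -> Prop) (c : K) f :
  f \in supported_in S -> c *: f \in supported_in S.
Proof. by move=> /asboolP fS; apply/asboolP => h /msuppZ_le /fS. Qed.

Lemma sr_polyX h : H h -> sr_poly (to_ring 'X_[h]) = 'X_[h].
Proof. by move=> Hh; apply/to_ringK/supported_inX. Qed.

Lemma ring_supp (a : KH) h : h \in msupp a -> H h.
Proof. by have /supported_inP := sr_polyP a; apply. Qed.

Hypothesis omega_sub : forall h, Om h -> H h.

Definition in_translate c := exists2 h, H h & c = (b + h)%MM.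
Definition outside c := Om c /\ ~ in_translate c.

Definition repr_poly (x : E) : {mpoly K[n]} := sr_poly (cm_val (repr x)).
(** The chosen representative is determined only modulo x^b R, so this coefficient is meaningful
    only at exponents not in [b + H]. *)
Definition qcoef c (x : E) : K := (repr_poly x)@_c.
Definition to_quot (f : {mpoly K[n]}) : E := quotmod_pi _ (insubd 0 (to_ring f : KH^o)).

Lemma repr_poly_supp x c : c \in msupp (repr_poly x) -> Om c.
Proof.
by have /supported_inP := cm_valP (repr x); apply.
Qed.

Lemma in_translateD c h : in_translate c -> H h -> in_translate (c + h)%MM.
Proof.
by move=> [g Hg ->] Hh; exists (g + h)%MM; [exact: submonoidD|rewrite addmA].
Qed.

Lemma pi_eqP (u v : canonical_module R K H) :
  (quotmod_pi (@in_monomial_submodule R K n H b) u = quotmod_pi _ v) <->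
  exists g : KH, sr_poly (cm_val u) - sr_poly (cm_val v) = sr_poly g * 'X_[b].
Proof.
split=> [/quotmod_piP/asboolP[g gE]|[g gE]]; first by exists g.
by apply/quotmod_piP/asboolP; exists g.
Qed.

Lemma qcoef_mulXb (g : KH) c : ~ in_translate c -> (sr_poly g * 'X_[b])@_c = 0.
Proof.
move=> cb; apply: memN_msupp_eq0; apply/negP.
rewrite (perm_mem (msuppMX _ _)) => /mapP[h /ring_supp Hh cE].
by apply: cb; exists h.
Qed.

Lemma pi_qcoef (u : canonical_module R K H) c : ~ in_translate c ->
  qcoef c (quotmod_pi _ u) = (sr_poly (cm_val u))@_c.
Proof.
move=> cb; apply/eqP; rewrite -subr_eq0 -mcoeffB; apply/eqP.
have /pi_eqP[g ->] := quotmod_pi_repr (quotmod_pi (@in_monomial_submodule R K n H b) u).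
exact: qcoef_mulXb.
Qed.

Lemma to_quot_val f : f \in supported_in Om ->
  sr_poly (cm_val (insubd (0 : canonical_module R K H) (to_ring f : KH^o))) = f.
Proof.
move=> fO; have fH : f \in supported_in H.
  by apply/supported_inP => h; move/supported_inP: fO => fO /fO /omega_sub.
rewrite -[cm_val _]/(val _) insubdK ?to_ringK //.
by change (sr_poly (to_ring f) \in supported_in Om); rewrite to_ringK.
Qed.

Lemma qcoef_to_quot f c : f \in supported_in Om -> ~ in_translate c -> qcoef c (to_quot f) = f@_c.
Proof. by move=> fO cb; rewrite pi_qcoef // to_quot_val. Qed.

Lemma qcoef_repr (u : E) c : ~ in_translate c ->
  qcoef c u = (sr_poly (cm_val (repr u)))@_c.
Proof. by move=> cb; rewrite -[u in LHS]quotmod_pi_repr pi_qcoef. Qed.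

Lemma qcoefD c x y : ~ in_translate c -> qcoef c (x + y) = qcoef c x + qcoef c y.
Proof.
move=> cb; rewrite -[x in LHS]quotmod_pi_repr -[y in LHS]quotmod_pi_repr.
by rewrite -quotmod_piD pi_qcoef //= mcoeffD.
Qed.

Lemma qcoef0 c : ~ in_translate c -> qcoef c 0 = 0.
Proof.
move=> cb; have /eqP := qcoefD 0 0 cb; rewrite addr0 -[X in X == _]addr0.
by rewrite (inj_eq (addrI _)) eq_sym => /eqP.
Qed.

Lemma qcoef_sum c (I : Type) (s : seq I) (F : I -> E) : ~ in_translate c ->
  qcoef c (\sum_(i <- s) F i) = \sum_(i <- s) qcoef c (F i).
Proof.
move=> cb; elim: s => [|i s IH]; first by rewrite !big_nil qcoef0.
by rewrite !big_cons qcoefD // IH.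
Qed.

Lemma qcoefM c (a : KH) x : ~ in_translate c -> qcoef c (a *: x) = (sr_poly a * repr_poly x)@_c.
Proof.
move=> cb; rewrite -[x in LHS]quotmod_pi_repr.
by rewrite -[_ *: _]quotmod_piZ pi_qcoef.
Qed.

Lemma qcoefM_to_quot c (a : KH) f : f \in supported_in Om -> ~ in_translate c ->
  qcoef c (a *: to_quot f) = (sr_poly a * f)@_c.
Proof.
move=> fO cb; rewrite -[_ *: _]quotmod_piZ pi_qcoef //.
by rewrite -[sr_poly _]/(sr_poly a * sr_poly (cm_val (insubd 0 (to_ring f : KH^o)))) to_quot_val.
Qed.

Lemma qcoef_omega c x : qcoef c x != 0 -> Om c.
Proof. by rewrite /qcoef -mcoeff_msupp => /repr_poly_supp. Qed.

(** The difference of the representatives has all its exponents in [b + H]; dividing it by x^b term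
    by term gives the cofactor [g] in R. *)
Lemma qcoef_ext x y : (forall c, outside c -> qcoef c x = qcoef c y) -> x = y.
Proof.
move=> xy; rewrite -[x]quotmod_pi_repr -[y]quotmod_pi_repr; apply/pi_eqP.
set f := _ - _.
have fb c : c \in msupp f -> in_translate c.
  move=> cf; apply: contrapT => cb; move: cf; rewrite mcoeff_msupp mcoeffB.
  rewrite -!qcoef_repr //; suff -> : qcoef c x = qcoef c y by rewrite subrr eqxx.
  have [/eqP x0|/qcoef_omega Oc] := boolP (qcoef c x == 0); last by apply: xy.
  have [/eqP y0|/qcoef_omega Oc] := boolP (qcoef c y == 0); last by apply: xy.
  by rewrite x0 y0.
pose g := \sum_(c <- msupp f) f@_c *: 'X_[(c - b)%MM].
have gH : g \in supported_in H.
  rewrite /g big_seq; elim/big_ind: _ => [|p q|c /fb[h Hh ->]].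
  - exact: supported_in0.
  - exact: supported_inD.
  - by rewrite addmC addmK; apply/supported_inZ/supported_inX.
exists (to_ring g); rewrite to_ringK // [LHS]mpolyE /g mulr_suml big_seq [RHS]big_seq.
apply: eq_bigr => c /fb[h Hh ->].
by rewrite -scalerAl -mpolyXD [(b + h)%MM]addmC addmK.
Qed.

Lemma qcoefXD h c x : H h -> ~ in_translate (h + c)%MM ->
  qcoef (h + c)%MM (to_ring 'X_[h] *: x) = qcoef c x.
Proof. by move=> Hh cb; rewrite qcoefM // sr_polyX // mulrC mcoeffMX. Qed.

Lemma qcoefX0 h c x : H h -> ~ in_translate c ->
  (forall c', Om c' -> c <> (h + c')%MM) -> qcoef c (to_ring 'X_[h] *: x) = 0.
Proof.
move=> Hh cb hc; rewrite qcoefM // sr_polyX // mulrC.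
apply: memN_msupp_eq0; apply/negP; rewrite (perm_mem (msuppMX _ _)).
by case/mapP => c' /repr_poly_supp Oc' /hc; apply.
Qed.

Lemma qcoefM_neq0 a x c : ~ in_translate c -> qcoef c (a *: x) != 0 ->
  exists h c', [/\ h \in msupp (sr_poly a), outside c', qcoef c' x != 0 & c = (h + c')%MM].
Proof.
move=> cb; rewrite qcoefM // -mcoeff_msupp => /msuppM_le/allpairsP[[h c'] /=].
move=> [ha c'x cE]; exists h, c'; split=> //; last by rewrite /qcoef -mcoeff_msupp.
split; first exact: repr_poly_supp c'x.
move=> /in_translateD/(_ (ring_supp ha)); rewrite addmC -cE; exact: cb.
Qed.

Lemma constant_supported (k : K) : k%:MP \in @supported_in K n H.
Proof.
apply/asboolP => h; rewrite msuppC; case: eqP => // _.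
by rewrite inE => /eqP ->; exact: submonoid0.
Qed.

Lemma qcoefC c (k : K) x : ~ in_translate c -> qcoef c (to_ring k%:MP *: x) = k * qcoef c x.
Proof. by move=> cb; rewrite qcoefM // to_ringK ?constant_supported // mcoeffCM. Qed.

Lemma scale_const0 (x : E) : to_ring 0%:MP *: x = 0.
Proof. by apply: qcoef_ext => c [_ cb]; rewrite qcoefC // qcoef0 // mul0r. Qed.

Lemma scale_constK (k : K) (x : E) : k != 0 -> to_ring k^-1%:MP *: (to_ring k%:MP *: x) = x.
Proof. by move=> k0; apply: qcoef_ext => c [_ cb]; rewrite !qcoefC // mulKf. Qed.

Lemma qcoef_to_quotX c c' : Om c -> ~ in_translate c' -> qcoef c' (to_quot 'X_[c]) = (c == c')%:R.
Proof. by move=> Oc cb; rewrite qcoef_to_quot ?mcoeffX //; exact: supported_inX. Qed.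

Lemma to_quotXD h c : H h -> Om c -> to_quot 'X_[(h + c)%MM] = to_ring 'X_[h] *: to_quot 'X_[c].
Proof.
move=> Hh Oc; have Ohc : Om (h + c)%MM by rewrite addmC; exact: semigroup_omegaD.
apply: qcoef_ext => c' [Oc' c'b]; rewrite qcoef_to_quotX //.
have [hcE|hcc] := eqVneq.
  have cb : ~ in_translate c by move=> /in_translateD/(_ Hh); rewrite addmC hcE.
  by rewrite -hcE qcoefXD ?hcE // qcoef_to_quotX // eqxx.
apply/esym/eqP/negPn/negP => /(qcoefM_neq0 c'b)[h'[c'' []]].
rewrite sr_polyX // msuppX inE => /eqP -> [Oc'' c''b]; rewrite qcoef_to_quotX //.
case: (c =P c'') => [cc _ cE|_]; last by rewrite mulr0n eqxx.
move: hcc; rewrite cE cc. by rewrite eqxx.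
Qed.

Lemma to_quotX0 c : Om c -> in_translate c -> to_quot 'X_[c] = 0.
Proof.
move=> Oc cb; apply: qcoef_ext => c' [Oc' c'b]; rewrite qcoef_to_quotX // qcoef0 //.
by case: eqP => // cE; move: cb; rewrite cE.
Qed.

Lemma quot_decomp x : x = \sum_(c <- msupp (repr_poly x)) to_ring (qcoef c x)%:MP *: to_quot 'X_[c].
Proof.
apply: qcoef_ext => c [Oc cb]; rewrite qcoef_sum // big_seq.
rewrite (eq_bigr (fun c' => (qcoef c' x *: 'X_[c'])@_c)) => [|c' /repr_poly_supp Oc'].
  by rewrite -big_seq -raddf_sum -mpolyE.
by rewrite qcoefC // qcoef_to_quotX // mcoeffZ mcoeffX.
Qed.

(** * Powers of the maximal ideal, chains of submodules and numbers of generators *)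

Lemma max_idealP (a : KH) : mmax a <-> 0%MM \notin msupp (sr_poly a).
Proof.
split=> [[s [sH ->]]|a0].
  rewrite -mcoeff_eq0 raddf_sum big_seq big1 // => p /sH[Hp p0]; apply/eqP.
  rewrite mcoeff_eq0 (perm_mem (msuppMX _ _)); apply/mapP => -[h _ /esym/eqP].
  by rewrite mnmD_eq0 (negPf p0).
exists [seq (to_ring (a@_h)%:MP, h) | h <- msupp (sr_poly a)]; split.
  move=> _ /mapP[h ha ->] /=; split; first exact: ring_supp ha.
  by apply: contraNneq a0 => <-.
rewrite big_map [LHS]mpolyE; apply: eq_bigr => h _ /=.
by rewrite to_ringK ?mul_mpolyC // constant_supported.
Qed.

Lemma max_idealX h : H h -> h != 0%MM -> mmax (to_ring 'X_[h]).
Proof. by move=> Hh h0; apply/max_idealP; rewrite sr_polyX // msuppX inE eq_sym. Qed.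

(** The exponents of the monomials in m^k omega_R. *)
Fixpoint omega_pow k c : Prop :=
  if k is j.+1 then
    exists h c', [/\ H h, h != 0%MM, omega_pow j c' & c = (h + c')%MM]
  else Om c.

Lemma omega_pow_omega k c : omega_pow k c -> Om c.
Proof.
elim: k c => // k IH c [h [c' [Hh _ /IH Oc' ->]]].
by rewrite addmC; exact: semigroup_omegaD.
Qed.

Lemma omega_pow_up k h c : H h -> omega_pow k c -> omega_pow k (h + c)%MM.
Proof.
elim: k h c => [|k IH] h c Hh /=; first by rewrite addmC => /semigroup_omegaD; apply.
move=> [g [c' [Hg g0 /(IH _ _ Hh) hc' ->]]]; exists g, (h + c')%MM.
by split=> //; rewrite !addmA [(h + g)%MM]addmC.
Qed.

Definition supp_span (S : 'X_{1..n} -> Prop) : set E :=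
  [set x | forall c, outside c -> qcoef c x != 0 -> S c].

Lemma ideal_mulD (N : set E) u v :
  ideal_mul mmax N u -> ideal_mul mmax N v -> ideal_mul mmax N (u + v).
Proof.
move=> [s [sN ->]] [t [tN ->]]; exists (s ++ t); rewrite big_cat; split=> // p.
by rewrite mem_cat => /orP[/sN|/tN].
Qed.

(** Both m and the quotient are spanned by monomials, so membership in m^k E can be tested one
    exponent at a time; lengths become counts of lattice points. *)
Lemma ideal_pow_mulE k : ideal_pow_mul mmax k = supp_span (omega_pow k).
Proof.
rewrite /ideal_pow_mul; elim: k => [|k /= ->].
  by apply/seteqP; split=> // x _ c [].
apply/seteqP; split=> x.
  move=> [s [sN ->]] c [Oc cb] cx.
  have [p /sN[/max_idealP p0 pN] cp] : exists2 p, p \in s & qcoef c (p.1 *: p.2) != 0.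
    apply: contrapT => nex; move: cx; rewrite qcoef_sum // big_seq big1 ?eqxx //.
    move=> p ps; apply/eqP/negPn/negP => cp; apply: nex; by exists p.
  have [h [c' [ha oc' c'p ->]]] := qcoefM_neq0 cb cp.
  exists h, c'; split=> //; [exact: ring_supp ha| |exact: pN].
  by apply: contraNneq p0 => <-.
move=> xN; rewrite [x]quot_decomp big_seq; apply: big_ind.
- by exists [::]; rewrite big_nil.
- exact: ideal_mulD.
move=> c cx; have Oc := repr_poly_supp cx.
have [cb|cb] := pselect (in_translate c).
  by exists [::]; rewrite big_nil to_quotX0 // scaler0.
have [] := xN c; first by []; first by rewrite -mcoeff_msupp.
move=> h [c' [Hh h0 c'N cE]]; have Oc' := omega_pow_omega c'N.
exists [:: (to_ring 'X_[h], to_ring (qcoef c x)%:MP *: to_quot 'X_[c'])]; split.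
  move=> p; rewrite inE => /eqP -> /=; split; first exact: max_idealX.
  move=> d [Od db]; rewrite qcoefC // qcoef_to_quotX //.
  by case: (c' =P d) => [<- //|_]; rewrite mulr0 eqxx.
by rewrite big_seq1 /= cE to_quotXD // !scalerA mulrC.
Qed.

(** The submodule generated by the monomials with exponents in [S]. Translation by [H] is built in,
    so that the instance below holds for every [S]. *)
Definition mono_submod (S : 'X_{1..n} -> Prop) : {pred E} := fun x =>
  `[< supp_span (fun c => exists h s, [/\ H h, S s & c = (h + s)%MM]) x >].

Fact mono_submod_closed S : submod_closed (mono_submod S).
Proof.
split; first by apply/asboolP => c [_ cb]; rewrite qcoef0 // eqxx.
move=> a u v /asboolP uS /asboolP vS; apply/asboolP => c [Oc cb].
rewrite qcoefD //; have [/eqP ->|cau _] := boolP (qcoef c (a *: u) == 0).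
  by rewrite add0r; apply: vS.
have [h [c' [ha oc' c'u ->]]] := qcoefM_neq0 cb cau.
have [g [s [Hg Ss ->]]] := uS _ oc' c'u.
exists (h + g)%MM, s; split=> //; last by rewrite addmA.
by apply: submonoidD => //; exact: ring_supp ha.
Qed.
HB.instance Definition _ S := GRing.isSubmodClosed.Build KH E
  (mono_submod S) (mono_submod_closed S).

(** The points of [T] are added as generators in order of decreasing total degree. A new point is
    not a multiple of an earlier one, which has at least its degree, so every inclusion is
    strict. *)
Lemma chain_ge (S : 'X_{1..n} -> Prop) (T : seq 'X_{1..n}) :
    (forall h c, H h -> S c -> S (h + c)%MM) ->
    uniq T -> {in T, forall t, outside t /\ ~ S t} ->
  exists L : nat -> submodClosed E,
    (forall u, supp_span S u -> u \in L 0%N) /\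
    forall i, (i < size T)%N ->
      {subset L i <= L i.+1} /\ ~ {subset L i.+1 <= L i}.
Proof.
move=> Sup Tu TS.
pose T' := sort (fun x y => mdeg y <= mdeg x)%N T.
have sT : size T' = size T by rewrite size_sort.
have mT t : (t \in T') = (t \in T) by rewrite mem_sort.
exists (fun i => mono_submod (fun c => S c \/ c \in take i T') : submodClosed E).
split.
  move=> u uS; apply/asboolP => c oc cu; exists 0%MM, c; rewrite add0m.
  by split; [exact: submonoid0|left; exact: uS|].
move=> i iT; pose t := nth 0%MM T' i; have it : (i < size T')%N by rewrite sT.
split.
  move=> u /asboolP uS; apply/asboolP => c oc /(uS _ oc)[h [s [Hh Ss ->]]].
  exists h, s; split=> //; case: Ss => [|st]; [by left|right].
  by rewrite (take_nth 0%MM) // mem_rcons inE st orbT.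
have [[Ot tb] tS] : outside t /\ ~ S t by apply: TS; rewrite -mT mem_nth.
move=> /(_ (to_quot 'X_[t])) sub.
have /sub/asboolP : to_quot 'X_[t] \in mono_submod (fun c => S c \/ c \in take i.+1 T').
  apply/asboolP => c [Oc cb]; rewrite qcoef_to_quotX //; case: (t =P c) => [<- _|_]; last by rewrite mulr0n eqxx.
  exists 0%MM, t; rewrite add0m; split=> //; first exact: submonoid0.
  by right; rewrite (take_nth 0%MM) // mem_rcons inE eqxx.
case/(_ t); [by []|by rewrite qcoef_to_quotX // eqxx oner_eq0|].
move=> h [s [Hh [Ss|/(nthP 0%MM)[j ji sE]] tE]].
  by apply: tS; rewrite tE; exact: Sup.
move: ji sE; rewrite size_takel ?(ltnW it) // => ji; rewrite nth_take // => sE.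
have degts : (mdeg t <= mdeg s)%N.
  rewrite -sE; apply: (@sorted_leq_nth _ (fun x y => mdeg y <= mdeg x)%N) => //.
  - by move=> x y z yx zx; exact: leq_trans yx.
  - by apply: sort_sorted => x y; exact: leq_total.
  - by rewrite inE; exact: ltn_trans it.
  - exact: ltnW.
have /eqP h0 : h == 0%MM.
  by rewrite -mdeg_eq0 -leqn0 -(leq_add2r (mdeg s)) -mdegD -tE.
have := sort_uniq (fun x y => mdeg y <= mdeg x)%N T; rewrite Tu -/T' => T'u.
have := nth_uniq 0%MM (ltn_trans ji it) it T'u.
by rewrite sE -/t tE h0 add0m eqxx (ltn_eqF ji).
Qed.

(** The coefficient matrix has more rows than columns, hence a nonzero left kernel vector. *)
Lemma dependence (T : seq 'X_{1..n}) k (e : 'I_k -> E) :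
    {in T, forall t, ~ in_translate t} -> (size T < k)%N ->
  exists2 v : 'rV[K]_k, v != 0 &
    {in T, forall t, qcoef t (\sum_i to_ring (v 0 i)%:MP *: e i) = 0}.
Proof.
move=> Tb Tk; pose A : 'M_(k, size T) := \matrix_(i, j) qcoef (nth 0%MM T j) (e i).
have /rowV0Pn[v /sub_kermxP vA v0] : kermx A != 0.
  rewrite kermx_eq0 /row_free; apply: contraTneq Tk => <-.
  by rewrite -leqNgt rank_leq_col.
exists v => // t tT; rewrite qcoef_sum; last exact: Tb.
have tE := nth_index 0%MM tT.
have tlt : (index t T < size T)%N by rewrite index_mem.
transitivity ((v *m A) 0 (Ordinal tlt)); last by rewrite vA mxE.
by rewrite mxE; apply: eq_bigr => i _; rewrite [A _ _]mxE /= tE qcoefC; last exact: Tb.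
Qed.

(** Elements chosen in the successive steps of a chain are linearly independent modulo [N], while
    the coefficients at [T] embed the quotient by [N] in a space of dimension [size T]. *)
Lemma chain_le (N : set E) (T : seq 'X_{1..n}) k (L : nat -> submodClosed E) :
    {in T, forall t, ~ in_translate t} ->
    (forall u, {in T, forall t, qcoef t u = 0} -> N u) ->
    (forall u, N u -> u \in L 0%N) ->
    (forall i, (i < k)%N ->
      {subset L i <= L i.+1} /\ ~ {subset L i.+1 <= L i}) ->
  (k <= size T)%N.
Proof.
move=> Tb TN NL Lch; rewrite leqNgt; apply/negP => Tk.
have Lmono i j : (i <= j <= k)%N -> {subset L i <= L j}.
  elim: j => [|j IH] /andP[]; first by rewrite leqn0 => /eqP -> _ u.
  rewrite leq_eqVlt => /predU1P[-> _ u //|]; rewrite ltnS => ij jk u uL.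
  apply: (Lch j jk).1; apply: (IH _ u uL); by rewrite ij ltnW.
have /choice[e eL] (i : 'I_k) : exists u, u \in L i.+1 /\ u \notin L i.
  have [_ /existsNP[u]] := Lch i (ltn_ord i).
  by move=> /not_implyP[u1 /negP u2]; exists u.
have [v v0 vT] := dependence e Tb Tk.
have [i1 vi1] : exists i, v 0 i != 0.
  apply: contrapT => nex; move/eqP: v0; apply; apply/rowP => i; rewrite mxE.
  by apply/eqP/negPn/negP => vi; apply: nex; exists i.
(* With the largest index carrying a nonzero coefficient, all other terms and the whole sum lie in
   [L i0], hence so does [e i0]. *)
have [i0 vi0 imax] := @arg_maxnP _ i1 (fun i => v 0 i != 0) val vi1.
pose u := \sum_i to_ring (v 0 i)%:MP *: e i.
have uN : N u by exact: TN.
have uL : u \in L i0 by apply: (@Lmono 0%N i0 _ u (NL _ uN)); rewrite leq0n ltnW.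
have [_ /negP] := eL i0; apply.
have eE : to_ring (v 0 i0)%:MP *: e i0 = u - \sum_(i | i != i0) to_ring (v 0 i)%:MP *: e i.
  by rewrite /u (bigD1 i0) //= addrK.
have : to_ring (v 0 i0)%:MP *: e i0 \in L i0.
  rewrite eE -scaleN1r; apply: rpredD => //; apply: rpredZ; apply: rpred_sum => i ii0.
  have [->|vi] := eqVneq (v 0 i) 0; first by rewrite scale_const0 rpred0.
  apply: rpredZ; apply: (Lmono i.+1); last exact: (eL i).1.
  by rewrite (ltnW (ltn_ord i0)) andbT ltn_neqAle ii0; exact: imax.
by move=> eL0; rewrite -[e i0](scale_constK _ vi0); exact: rpredZ.
Qed.

Lemma gens_le (G : seq 'X_{1..n}) :
    {in G, forall g, Om g} ->
    (forall c, outside c -> exists h g, [/\ H h, g \in G & c = (h + g)%MM]) ->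
  exists s : seq E, size s = size G /\
    forall u, exists c : nat -> KH, u = \sum_(i < size s) c i *: s`_i.
Proof.
move=> GO Gg; exists [seq to_quot 'X_[g] | g <- G]; split; first by rewrite size_map.
move=> u; set s := map _ _; rewrite [u]quot_decomp big_seq.
apply: (big_ind (fun v => exists c : nat -> KH, v = \sum_(i < size s) c i *: s`_i)).
- by exists (fun=> 0); rewrite big1 // => i _; rewrite scale0r.
- move=> _ _ [c1 ->] [c2 ->]; exists (fun i => c1 i + c2 i).
  by rewrite -big_split; apply: eq_bigr => i _; rewrite scalerDl.
move=> c /repr_poly_supp Oc; have [cb|cb] := pselect (in_translate c).
  exists (fun=> 0); rewrite to_quotX0 // scaler0 big1 // => i _; exact: scale0r.
have [//|h [g [Hh gG cE]]] := Gg c.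
have gi : (index g G < size s)%N by rewrite size_map index_mem.
exists (fun i => if i == index g G then to_ring (qcoef c u)%:MP * to_ring 'X_[h] else 0).
rewrite (bigD1 (Ordinal gi)) //= eqxx big1 ?addr0 => [|i /negPf].
  rewrite (nth_map 0%MM) -?index_mem ?index_mem // nth_index // cE to_quotXD ?scalerA //.
  exact: GO.
by rewrite -val_eqE /= => ->; rewrite scale0r.
Qed.

(** A minimal exponent is reached only through the constant term of [a], so the coefficient at [g]
    factors through E/mE. *)
Lemma qcoefM_minimal g a x : outside g ->
    (forall h c, H h -> Om c -> g = (h + c)%MM -> h = 0%MM) ->
  qcoef g (a *: x) = (sr_poly a)@_0%MM * qcoef g x.
Proof.
move=> [Og gb] gmin; rewrite -qcoefC // -[a in LHS](subrK (to_ring ((sr_poly a)@_0)%:MP)).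
rewrite scalerDl qcoefD // [X in X + _](_ : _ = 0) ?add0r //.
apply/eqP/negPn/negP => /(qcoefM_neq0 gb)[h [c [ha [Oc _] _ gE]]].
have h0 := gmin h c (ring_supp ha) Oc gE; move: ha.
by rewrite h0 mcoeff_msupp /= mcoeffB to_ringK ?constant_supported // mcoeffC eqxx mulr1 subrr eqxx.
Qed.

(** Nakayama's bound as a rank inequality: writing each x^g in terms of [s] and reading the
    coefficients at [G] factors the identity matrix through [size s] columns. *)
Lemma gens_ge (G : seq 'X_{1..n}) (s : seq E) :
    uniq G -> {in G, forall g, outside g} ->
    {in G, forall g h c, H h -> Om c -> g = (h + c)%MM -> h = 0%MM} ->
    (forall u, exists c : nat -> KH, u = \sum_(i < size s) c i *: s`_i) ->
  (size G <= size s)%N.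
Proof.
move=> Gu Go Gmin /choice[a aE].
pose A : 'M[K]_(size G, size s) :=
  \matrix_(i, j) (sr_poly (a (to_quot 'X_[nth 0%MM G i]) j))@_0%MM.
pose B : 'M[K]_(size s, size G) := \matrix_(j, i) qcoef (nth 0%MM G i) s`_j.
suff AB : A *m B = 1%:M.
  have := mxrankM_maxr A B; rewrite AB mxrank1 => /leq_trans; apply.
  exact: rank_leq_row.
apply/matrixP => i k; rewrite !mxE.
have Gi := mem_nth 0%MM (ltn_ord i); have Gk := mem_nth 0%MM (ltn_ord k).
have [[Oi _] [Ok kb]] := (Go _ Gi, Go _ Gk).
transitivity (qcoef (nth 0%MM G k) (to_quot 'X_[nth 0%MM G i])).
  rewrite [X in qcoef _ X]aE qcoef_sum //; apply: eq_bigr => j _; rewrite !mxE.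
  by rewrite qcoefM_minimal //; exact: Gmin.
by rewrite qcoef_to_quotX // nth_uniq.
Qed.

End MonomialQuotient.

(** * Face ideals *)

Section FaceIdeals.
Import Order.TTheory GRing.Theory Num.Theory.
Local Open Scope ring_scope.

Variables (K : fieldType) (n : nat) (H : submonoid n).
Local Notation KH := (semigroup_ring K H).
Local Notation to_ring := (@to_ring K n H).

Lemma sr_polyM (x y : KH) : sr_poly (x * y) = sr_poly x * sr_poly y.
Proof. by []. Qed.

Lemma sr_poly_sum (I : Type) (s : seq I) (F : I -> KH) :
  sr_poly (\sum_(i <- s) F i) = \sum_(i <- s) sr_poly (F i).
Proof. by elim: s => [|i s IH]; rewrite ?big_nil // !big_cons -IH. Qed.

Lemma to_ringM f g : f \in supported_in H -> g \in supported_in H ->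
  to_ring (f * g) = to_ring f * to_ring g.
Proof.
move=> fH gH; apply: val_inj; rewrite /= !to_ringK //.
by apply: supported_inM fH gH => x y; exact: submonoidD.
Qed.

Lemma to_ringB (f g : {mpoly K[n]}) : f \in supported_in H -> g \in supported_in H ->
  to_ring (f - g) = to_ring f - to_ring g.
Proof.
by move=> fH gH; apply: val_inj; rewrite /= !to_ringK //; exact: supported_inB.
Qed.

Lemma submonoidMn h k : H h -> H (h *+ k)%MM.
Proof.
by move=> Hh; elim: k => [|k IH]; [exact: submonoid0|rewrite mulmS; exact: submonoidD].
Qed.

Lemma to_ringXn h k : H h -> to_ring 'X_[h *+ k] = to_ring 'X_[h] ^+ k.
Proof.
move=> Hh; have hX := supported_inX K Hh; elim: k => [|k IH].
  by rewrite mulm0n expr0; apply: val_inj; rewrite /= sr_polyX ?mpolyX0 //; exact: submonoid0.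
rewrite mulmS mpolyXD to_ringM ?IH ?exprS //; exact/supported_inX/submonoidMn.
Qed.

Lemma ring_decomp (f : KH) : f = \sum_(h <- msupp f) to_ring (f@_h)%:MP * to_ring 'X_[h].
Proof.
apply: val_inj; rewrite -![val _]/(sr_poly _) sr_poly_sum [LHS]mpolyE.
rewrite big_seq [RHS]big_seq.
apply: eq_bigr => h hf; have Hh := ring_supp hf.
by rewrite sr_polyM sr_polyX // to_ringK ?constant_supported // mul_mpolyC.
Qed.

Lemma mcoeff_sumX (s : seq 'X_{1..n}) (F : 'X_{1..n} -> K) c : uniq s ->
  (\sum_(h <- s) F h *: 'X_[h])@_c = if c \in s then F c else 0.
Proof.
move=> su; rewrite raddf_sum /=; case: ifP => cs.
  rewrite (bigD1_seq c) //= mcoeffZ mcoeffX eqxx mulr1 big1 ?addr0 // => h /negPf hc.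
  by rewrite mcoeffZ mcoeffX hc mulr0.
rewrite big_seq big1 // => h hs; rewrite mcoeffZ mcoeffX.
by case: eqP => [hc|_]; [rewrite -hc hs in cs|rewrite mulr0].
Qed.

Lemma prime_exp (p : prime_idealr KH) f k : f ^+ k \in p -> f \in p.
Proof.
elim: k => [|k IH]; first by rewrite expr0 idealr1.
by rewrite exprS prime_idealrM => /orP[].
Qed.

Section Face.
Variables (v : 'X_{1..n} -> nat) (vD : forall g h, H g -> H h -> v (g + h)%MM = (v g + v h)%N).

Lemma grading0 : v 0%MM = 0%N.
Proof. by have := vD (submonoid0 H) (submonoid0 H); rewrite add0m; lia. Qed.

(** The ideal spanned by the monomials off the face [v = 0]. The additivity proof is an argument so
    that the ideal and prime structures can be inferred from the term. *)
Definition face_ideal of (forall g h, H g -> H h -> v (g + h)%MM = (v g + v h)%N)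
  : {pred KH} := fun f => `[< forall h, h \in msupp f -> (0 < v h)%N >].
Local Notation P := (face_ideal vD).

Lemma face_idealP f : reflect (forall h, h \in msupp (sr_poly f) -> (0 < v h)%N) (f \in P).
Proof. exact: asboolP. Qed.

Fact face_ideal_closed : idealr_closed P.
Proof.
split.
- by apply/face_idealP => h; rewrite msupp0.
- apply/face_idealP => /(_ 0%MM); rewrite msupp1 inE eqxx grading0.
  by move=> /(_ isT).
move=> a f g /face_idealP fP /face_idealP gP; apply/face_idealP => h.
rewrite -[sr_poly _]/(sr_poly a * sr_poly f + sr_poly g) => /msuppD_le.
rewrite mem_cat => /orP[/msuppM_le/allpairsP[[c d] /= [ca df ->]]|/gP //].
rewrite vD; [|exact: ring_supp ca|exact: ring_supp df].
by rewrite addn_gt0 (fP _ df) orbT.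
Qed.

(** The part of [f] supported on the face, which stands for its class modulo the face ideal. *)
Let res (f : {mpoly K[n]}) := \sum_(h <- msupp f) (if v h == 0%N then f@_h else 0) *: 'X_[h].

Let res_coef f c : (res f)@_c = if v c == 0%N then f@_c else 0.
Proof.
rewrite mcoeff_sumX //; case: ifP => // /negbT/memN_msupp_eq0 ->; by case: ifP.
Qed.

Let res_supp f h : h \in msupp (res f) -> h \in msupp f /\ v h = 0%N.
Proof.
by rewrite !mcoeff_msupp res_coef; case: (v h =P 0%N) => // _; rewrite eqxx.
Qed.

(** If neither factor lies in the ideal, both restrictions to the face are nonzero, and so is their
    product in the polynomial ring. An exponent [c] of that product lies on the face, and the
    remaining terms of [f * g] have positive [v], so [c] survives in [f * g]. *)
Fact face_ideal_prime : prime_idealr_closed P.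
Proof.
move=> f g /face_idealP fgP; have [//|/face_idealP/existsNP[h1 /not_implyP[h1f h10]]] := boolP (f \in P).
have [//|/face_idealP/existsNP[h2 /not_implyP[h2g h20]]] := boolP (g \in P).
have nz e h : h \in msupp e -> ~ (0 < v h)%N -> res e != 0.
  move=> he hv; apply/eqP => /(congr1 (mcoeff h)); rewrite res_coef mcoeff0.
  by rewrite ifT; [apply/eqP; rewrite -mcoeff_msupp|apply/eqP; lia].
have : res f * res g != 0 by rewrite mulf_neq0 ?(nz f h1) ?(nz g h2).
rewrite -msupp_eq0; case E : (msupp _) => [//|c s] _.
have cfg : c \in msupp (res f * res g) by rewrite E inE eqxx.
have /msuppM_le/allpairsP[[c1 c2] /= [/res_supp[c1f v1] /res_supp[c2g v2] cE]] := cfg.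
have vc : v c = 0%N 
  by rewrite cE vD ?v1 ?v2 //; [exact: ring_supp c1f|exact: ring_supp c2g].
have : (sr_poly f * sr_poly g)@_c != 0.
  have rest x y : {in msupp x, forall h, H h} -> {in msupp y, forall h, H h} ->
      {in msupp x, forall h, (0 < v h)%N} \/ {in msupp y, forall h, (0 < v h)%N} ->
      (x * y)@_c = 0.
    move=> xH yH xy; apply: memN_msupp_eq0; apply/negP.
    move=> /msuppM_le/allpairsP[[d1 d2] /= [d1x d2y dE]].
    have := vD (xH _ d1x) (yH _ d2y); rewrite -dE vc.
    by case: xy => [/(_ _ d1x)|/(_ _ d2y)]; lia.
  have subP e : {in msupp (e - res e), forall h, (0 < v h)%N /\ h \in msupp e}.
    move=> h; rewrite !mcoeff_msupp mcoeffB res_coef; case: posnP => _; last by rewrite subr0.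
    by rewrite subrr eqxx.
  have -> : sr_poly f * sr_poly g
      = res f * res g + (sr_poly f - res f) * res g + sr_poly f * (sr_poly g - res g) by ring.
  rewrite !mcoeffD [X in _ + X + _]rest ?[X in _ + X]rest ?addr0 -?mcoeff_msupp //.
  - by move=> h /ring_supp.
  - by move=> h /subP[_ /ring_supp].
  - by right => h /subP[].
  - by move=> h /subP[_ /ring_supp].
  - by move=> h /res_supp[/ring_supp].
  - by left => h /subP[].
by rewrite -mcoeff_msupp => /fgP; rewrite vc.
Qed.

HB.instance Definition _ := isIdealr.Build KH P face_ideal_closed.
HB.instance Definition _ := isPrimeIdealrClosed.Build KH P face_ideal_prime.

(** Some power of each monomial off the face is a multiple of x^a, so a prime containing x^a
    contains the monomial itself. *)
Lemma face_ideal_sub (p : prime_idealr KH) a :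
    H a -> to_ring 'X_[a] \in p ->
    (forall h, H h -> (0 < v h)%N -> exists d g, H g /\ (h *+ d = a + g)%MM) ->
  {subset P <= p}.
Proof.
move=> Ha ap dec f /face_idealP fP; rewrite [f]ring_decomp big_seq.
apply: rpred_sum => h hf; apply: idealMr; have Hh := ring_supp hf.
have [d [g [Hg hE]]] := dec h Hh (fP h hf).
apply: (@prime_exp _ _ d); rewrite -to_ringXn // hE mpolyXD.
by rewrite to_ringM ?prime_idealrM ?ap //; exact: supported_inX.
Qed.

Variable a : 'X_{1..n}.
Hypotheses (Ha : H a) (a0 : a != 0%MM).
Hypothesis vker : forall h, H h -> v h = 0%N -> exists k, h = (a *+ k)%MM.

(** The substitution of x^a for the variable; it is a section of the reduction modulo the face
    ideal. *)
Definition ray_poly (q : {poly K}) : {mpoly K[n]} := (map_poly (@mpolyC n K) q).['X_[a]].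

Lemma ray_polyM q r : ray_poly (q * r) = ray_poly q * ray_poly r.
Proof. by rewrite /ray_poly rmorphM hornerM. Qed.

Lemma ray_polyB q r : ray_poly (q - r) = ray_poly q - ray_poly r.
Proof. by rewrite /ray_poly rmorphB hornerD hornerN. Qed.

Lemma ray_polyE q : ray_poly q = \sum_(i < size q) q`_i *: 'X_[a *+ i].
Proof.
rewrite /ray_poly horner_coef size_map_poly; apply: eq_bigr => i _.
by rewrite coef_map /= mul_mpolyC mpolyXn.
Qed.

Lemma ray_poly_supp q : ray_poly q \in supported_in H.
Proof.
rewrite ray_polyE; elim/big_ind: _ => [|x y|i _]; [exact: supported_in0|exact: supported_inD|].
exact/supported_inZ/supported_inX/submonoidMn.
Qed.

Lemma mulm_inj i j : (a *+ i = a *+ j)%MM -> i = j.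
Proof.
move=> /(congr1 (@mdeg n)); rewrite !mdegMn => /eqP.
by rewrite eqn_pmul2l ?lt0n ?mdeg_eq0 // => /eqP.
Qed.

Lemma ray_poly_coef q i : (ray_poly q)@_(a *+ i) = q`_i.
Proof.
rewrite ray_polyE raddf_sum /=; have [iq|iq] := ltnP i (size q).
  rewrite (bigD1 (Ordinal iq)) //= mcoeffZ mcoeffX eqxx mulr1 big1 ?addr0 // => j ji.
  rewrite mcoeffZ mcoeffX; case: eqP => [/mulm_inj ij|]; last by rewrite mulr0.
  by move: ji; rewrite -val_eqE /= ij eqxx.
rewrite nth_default // big1 // => j _; rewrite mcoeffZ mcoeffX.
by case: eqP => [/mulm_inj ij|]; [move: (ltn_ord j); rewrite ij ltnNge iq|rewrite mulr0].
Qed.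

Lemma ray_poly_surj (f : KH) : exists q, f - to_ring (ray_poly q) \in P.
Proof.
(* The bound [msize f] loses nothing: [a] is nonzero, so [a *+ i] has degree at least [i]. *)
exists (\poly_(i < msize f) (sr_poly f)@_(a *+ i)); apply/face_idealP => h.
rewrite /= to_ringK ?ray_poly_supp // lt0n => hf; apply/eqP => vh.
have [i hE] : exists i, h = (a *+ i)%MM.
  apply: vker => //; move: hf => /msuppB_le; rewrite mem_cat => /orP[/ring_supp //|].
  by have /supported_inP := ray_poly_supp (\poly_(i < msize f) (sr_poly f)@_(a *+ i)); apply.
move: hf; rewrite mcoeff_msupp mcoeffB hE ray_poly_coef coef_poly.
case: ltnP => [_|ih]; first by rewrite subrr eqxx.
rewrite memN_msupp_eq0 ?subrr ?eqxx //; apply: msize_mdeg_ge.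
rewrite mdegMn; apply: (leq_trans ih); rewrite leq_pmull // lt0n mdeg_eq0 //.
Qed.

(* Modulo the face ideal the ring is the polynomial ring in [x^a]; a nonzero
   prime of the latter is generated by any of its elements of least degree. *)
Lemma face_prime_chain (p0 p1 p2 : prime_idealr KH) :
    {subset P <= p0} -> {subset p0 <= p1} -> {subset p1 <= p2} ->
    ~ {subset p1 <= p0} -> {subset p2 <= p1}.
Proof.
move=> Pp0 p01 p12 /existsNP[f /not_implyP[fp1 /negP fp0]].
have lift (p : prime_idealr KH) : {subset P <= p} -> forall g q,
    g - to_ring (ray_poly q) \in P -> (g \in p) = (to_ring (ray_poly q) \in p).
  by move=> Pp g q /Pp gq; rewrite -[g in LHS](subrK (to_ring (ray_poly q))) rpredDl.
have Pp1 : {subset P <= p1} by move=> g /Pp0/p01.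
have Pp2 : {subset P <= p2} by move=> g /Pp1/p12.
have [q fq] := ray_poly_surj f.
have q0 : q != 0.
  apply: contraNneq fp0 => q0; rewrite (lift _ Pp0 _ _ fq) q0.
  suff -> : to_ring (ray_poly 0) = 0 by exact: rpred0.
  by apply: val_inj; rewrite /= to_ringK ?ray_poly_supp // ray_polyE size_poly0 big_ord0.
pose I (p : prime_idealr KH) m := exists r : {poly K},
  [/\ r != 0, size r = m & to_ring (ray_poly r) \in p].
have least (p : prime_idealr KH) : {subset P <= p} -> (exists m, I p m) ->
    exists r, [/\ r != 0, to_ring (ray_poly r) \in p &
      forall s, (to_ring (ray_poly s) \in p) = (r %| s)].
  move=> Pp [m0 Im0]; have exI : exists m, `[< I p m >] by exists m0; apply/asboolP.
  case: (ex_minnP exI) => m /asboolP[r [r0 rm rp]] mmin.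
  exists r; split=> // s; apply/idP/idP => [sp|/dvdpP[t ->]]; last first.
    by rewrite ray_polyM to_ringM ?ray_poly_supp // idealMr.
  rewrite /dvdp; apply/negPn/negP => sr0.
  have : to_ring (ray_poly (s %% r)) \in p.
    have -> : s %% r = s - (s %/ r) * r by rewrite [X in X - _](divp_eq s r) addrC addKr.
    rewrite ray_polyB to_ringB ?ray_poly_supp // rpredB // ray_polyM to_ringM ?ray_poly_supp //.
    exact: idealMr.
  move=> srp; have /mmin : `[< I p (size (s %% r)) >] by apply/asboolP; exists (s %% r).
  by rewrite -rm leqNgt ltn_modp r0.
have q1 : to_ring (ray_poly q) \in p1 by rewrite -(lift _ Pp1 _ _ fq).
have q2 := p12 _ q1.
have [|r1 [r10 r1p1 dv1]] := least p1 Pp1; first by exists (size q), q.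
have [|r2 [r20 r2p2 dv2]] := least p2 Pp2; first by exists (size q), q.
have /dvdpP[t r1E] : r2 %| r1 by rewrite -dv2 p12.
have : to_ring (ray_poly t) * to_ring (ray_poly r2) \in p1.
  by rewrite -to_ringM ?ray_poly_supp // -ray_polyM -r1E.
(* Since [p1] is prime, either [r2] lies in [p1] and [p2] collapses onto [p1], or [t] does; then
   [r1] divides [t], which makes [r2] a constant and [p2] the unit ideal. *)
rewrite prime_idealrM => /orP[|]; last first.
  rewrite dv1 => r12 g gp2; have [s gs] := ray_poly_surj g.
  rewrite (lift _ Pp1 _ _ gs) dv1; apply: dvdp_trans r12 _.
  by rewrite -dv2 -(lift _ Pp2 _ _ gs).
rewrite dv1 => r1t; have t0 : t != 0 by apply: contraNneq r10 => t0; rewrite r1E t0 mul0r.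
have := dvdp_leq t0 r1t; rewrite r1E size_mul // => st.
have /size_poly1P[c c0 r2c] : size r2 == 1%N.
  by move: st t0 r20; rewrite -!size_poly_gt0; move: (size t) (size r2); clear => i j; lia.
have : (1 : KH) \in p2.
  suff -> : 1 = to_ring (ray_poly 1) by rewrite dv2 r2c dvdp1 size_polyC c0.
  by apply: val_inj; rewrite /= to_ringK ?ray_poly_supp // /ray_poly rmorph1 hornerC.
by rewrite idealr1.
Qed.

End Face.
End FaceIdeals.

(** * Dimension and depth *)

Section Dimension.
Import Order.TTheory GRing.Theory Num.Theory.
Local Open Scope ring_scope.

Variables (R : realType) (K : fieldType) (n : nat) (H : submonoid n).
Variable (b : 'X_{1..n}).
Local Notation KH := (semigroup_ring K H).
Local Notation Om := (semigroup_omega R H).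
Local Notation E := (omega_quotient R K H b).
Local Notation mmax := (graded_max_ideal K H).
Local Notation to_ring := (@to_ring K n H).
Local Notation to_quot := (@to_quot R K n H b).
Local Notation in_translate := (@in_translate n H b).
Local Notation outside := (@outside R n H b).

Hypothesis omega_sub : forall h, Om h -> H h.

Lemma annihilator_translate h : H h -> in_translate h -> annihilator E (to_ring 'X_[h]).
Proof.
move=> Hh hb u; apply: qcoef_ext => c [Oc cb]; rewrite qcoef0 //.
apply/eqP/negPn/negP => /(qcoefM_neq0 cb)[h' [c' [h'h [Oc' _] _ cE]]]; apply: cb.
move: h'h; rewrite sr_polyX // msuppX inE => /eqP h'h.
by rewrite cE h'h; apply: in_translateD => //; exact: omega_sub.
Qed.

Lemma mdeg_grading g h : H g -> H h -> mdeg (g + h)%MM = (mdeg g + mdeg h)%N.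
Proof. by move=> _ _; exact: mdegD. Qed.

(** The chain is the ideal of the face [v = 0] inside the maximal ideal, the latter being the face
    ideal of the total degree. An annihilator has no exponent on the face, because translates of [c]
    along the face never enter [b + H]. *)
Lemma krull_chain1 v (vD : forall g h, H g -> H h -> v (g + h)%MM = (v g + v h)%N) a c :
    H a -> a != 0%MM -> v a = 0%N -> Om c ->
    (forall h, H h -> v h = 0%N -> ~ in_translate (h + c)%MM) ->
  exists p : nat -> prime_idealr KH,
    (forall f, annihilator E f -> f \in p 0%N) /\
    forall i, (i < 1)%N -> {subset p i <= p i.+1} /\ ~ {subset p i.+1 <= p i}.
Proof.
move=> Ha a0 va Oc cb.
exists (fun i : nat => if i is 0%N then (face_ideal vD : prime_idealr KH)
  else (face_ideal mdeg_grading : prime_idealr KH)); split=> [f fE|[|//] _].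
  apply/face_idealP => h hf; rewrite lt0n; apply/eqP => vh.
  have hcb := cb _ (ring_supp hf) vh.
  have := qcoef0 R K hcb; rewrite -(fE (to_quot 'X_[c])) qcoefM_to_quot //; last exact: supported_inX.
  by rewrite addmC mcoeffMX => /eqP; rewrite mcoeff_eq0 hf.
split=> [f /face_idealP fP|sub].
  apply/face_idealP => h /fP vh; rewrite lt0n mdeg_eq0.
  by apply: contraTneq vh => ->; rewrite (grading0 vD).
have /sub/face_idealP/(_ a) : to_ring 'X_[a] \in face_ideal mdeg_grading.
  by apply/face_idealP => h; rewrite sr_polyX // msuppX inE lt0n mdeg_eq0 => /eqP ->.
by rewrite sr_polyX // msuppX inE eqxx va => /(_ isT).
Qed.

(** A product of powers of x^a1 and x^a2 kills the module, so [p 0] contains one of these monomials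
    and with it the ideal of the face spanned by the other ray. Above a face ideal only one strict
    inclusion is possible. *)
Lemma krull_le1 k (p : nat -> prime_idealr KH)
    v1 (vD1 : forall g h, H g -> H h -> v1 (g + h)%MM = (v1 g + v1 h)%N)
    v2 (vD2 : forall g h, H g -> H h -> v2 (g + h)%MM = (v2 g + v2 h)%N)
    a1 a2 N :
    H a1 -> a1 != 0%MM -> (forall h, H h -> v1 h = 0%N -> exists k, h = (a1 *+ k)%MM) ->
    H a2 -> a2 != 0%MM -> (forall h, H h -> v2 h = 0%N -> exists k, h = (a2 *+ k)%MM) ->
    (forall h, H h -> (0 < v1 h)%N -> exists d g, H g /\ (h *+ d = a2 + g)%MM) ->
    (forall h, H h -> (0 < v2 h)%N -> exists d g, H g /\ (h *+ d = a1 + g)%MM) ->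
    in_translate (a1 *+ N + a2 *+ N)%MM ->
    (forall f, annihilator E f -> f \in p 0%N) ->
    (forall i, (i < k)%N -> {subset p i <= p i.+1} /\ ~ {subset p i.+1 <= p i}) ->
  (k <= 1)%N.
Proof.
move=> H1 a10 ker1 H2 a20 ker2 dec1 dec2 Nb annp pch.
rewrite leqNgt; apply/negP => k2.
have [p01 p10] := pch 0%N (ltnW k2); have [p12] := pch 1%N k2; apply.
have Hn1 := submonoidMn N H1; have Hn2 := submonoidMn N H2.
have : to_ring 'X_[a1 *+ N + a2 *+ N] \in p 0%N by apply/annp/annihilator_translate => //; exact: submonoidD.
rewrite mpolyXD to_ringM; [|exact: supported_inX..].
rewrite !to_ringXn // prime_idealrM => /orP[] /prime_exp.
  move=> a1p; apply: (face_prime_chain H2 a20 ker2 (vD := vD2)) p10 => //.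
  exact: face_ideal_sub a1p dec2.
move=> a2p; apply: (face_prime_chain H1 a10 ker1 (vD := vD1)) p10 => //.
exact: face_ideal_sub a2p dec1.
Qed.

(** A regular sequence must not generate the whole module, so the second hypothesis rules out any
    sequence with two or more members. *)
Lemma depth_eq1 :
    (exists f : KH, [/\ mmax f, forall u : E, f *: u = 0 -> u = 0
       & exists u : E, forall v, u <> f *: v]) ->
    (forall f g : KH, mmax f -> mmax g -> (forall u : E, f *: u = 0 -> u = 0) ->
       (forall u v : E, g *: u = f *: v -> exists w, u = f *: w) ->
       forall u : E, exists v w, u = f *: v + g *: w) ->
  depth mmax E 1.
Proof.
move=> [f [fm freg [u uf]]] le1.
have mul0 (v : E) : seq_mul [::] v <-> v = 0.
  by split=> [[w]|->]; [rewrite big_ord0|exists (fun=> 0); rewrite big_ord0].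
have mul1 (g : KH) (v : E) : seq_mul [:: g] v <-> exists w, v = g *: w.
  split=> [[w]|[w ->]]; first by rewrite big_ord1; exists (w 0%N).
  by exists (fun=> w); rewrite big_ord1.
split.
  exists [:: f]; split=> //; first by move=> g; rewrite inE => /eqP ->.
  split=> [[|//] _ v /=|]; last by exists u; move=> /mul1[v /uf].
  by move=> /mul0 /freg ->; exact/mul0.
move=> j [[|g [|h r]] [<- //= rm [reg [v vr]]]]; exfalso; apply: vr.
have [v' [w ->]] : exists x y, v = g *: x + h *: y.
  apply: le1 => [||x gx|x y hxy].
  - by apply: rm; rewrite inE eqxx.
  - by apply: rm; rewrite !inE eqxx orbT.
  - by apply/mul0; apply: (reg 0%N) => //=; exact/mul0.
  - by apply/mul1; apply: (reg 1%N) => //=; apply/mul1; exists y.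
exists (fun i => if i is 0%N then v' else if i is 1%N then w else 0).
rewrite /= !big_ord_recl /= big1 ?addr0 // => i _; exact: scaler0.
Qed.

(** An exhaustion of the basis monomials by finite levels of linear growth, where multiplication by
    a monomial raises the level by a bounded amount. This is the form in which dimension one enters
    the bound on the depth. *)
Variables (A : nat -> seq 'X_{1..n}) (e0 : nat).
Hypotheses (A_uniq : forall M, uniq (A M)) (A_size : forall M, size (A M) = (e0 * M)%N)
  (A_out : forall M, {in A M, forall c, outside c})
  (A_le : forall M N, (M <= N)%N -> {subset A M <= A N})
  (A_exh : forall c, outside c -> exists M, c \in A M)
  (A_shift : forall h, H h -> exists D, forall M c, c \in A M ->
     (h + c)%MM \in A (M + D) \/ in_translate (h + c)%MM).

Lemma qcoef_level (x : E) : exists M, forall N c, (M <= N)%N -> outside c ->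
  qcoef c x != 0 -> c \in A N.
Proof.
suff : forall s : seq 'X_{1..n}, exists M, forall N c, (M <= N)%N -> outside c ->
    c \in s -> c \in A N.
  move=> /(_ (msupp (repr_poly x)))[M MP]; exists M => N c MN oc cx; apply: MP => //.
  by rewrite mcoeff_msupp.
elim=> [|c s [M MP]]; first by exists 0%N.
have [oc|noc] := pselect (outside c); last first.
  exists M => N d MN od; rewrite inE => /predU1P[dc|]; last exact: MP.
  by case: noc; rewrite -dc.
have [M' M'c] := A_exh oc; exists (maxn M M') => N d; rewrite geq_max => /andP[MN MN'] od.
by rewrite inE => /predU1P[->|]; [exact: A_le M'c|exact: MP].
Qed.

Lemma level_family (F : nat -> E) k : exists M, forall i N c, (i < k)%N -> (M <= N)%N ->
  outside c -> qcoef c (F i) != 0 -> c \in A N.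
Proof.
elim: k => [|k [M MP]]; first by exists 0%N.
have [M' M'P] := qcoef_level (F k); exists (maxn M M') => i N c.
rewrite ltnS leq_eqVlt geq_max => /predU1P[->|ik] /andP[MN MN']; first exact: M'P.
exact: MP.
Qed.

Lemma shift_bound (f : KH) : exists D, forall M c h, h \in msupp (sr_poly f) ->
  c \in A M -> (h + c)%MM \in A (M + D) \/ in_translate (h + c)%MM.
Proof.
suff : forall s : seq 'X_{1..n}, {in s, forall h, H h} -> exists D, forall M c h,
    h \in s -> c \in A M -> (h + c)%MM \in A (M + D) \/ in_translate (h + c)%MM.
  by apply => h /ring_supp.
elim=> [|h s IH] sH; first by exists 0%N.
have [h' h's|D DP] := IH; first by apply: sH; rewrite inE h's orbT.
have [D' D'P] := A_shift (sH h (mem_head _ _)).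
exists (maxn D D') => M c g; rewrite inE => /predU1P[->|gs] cM.
  have [gA|] := D'P _ _ cM; [left|by right].
  by apply: A_le gA; rewrite leq_add2l leq_maxr.
have [gA|] := DP _ _ _ gs cM; [left|by right].
by apply: A_le gA; rewrite leq_add2l leq_maxl.
Qed.

(* The elements [f x^c], [c \in A M], and [u, g u, g^2 u, ...] lie in the span
   of [A (M + D)], whose dimension exceeds the number of the former by a
   constant; so some nonzero polynomial in [g] sends [u] into [f E]. *)
Lemma depth_le1 (f g : KH) :
    (forall u : E, f *: u = 0 -> u = 0) ->
    (forall u v : E, g *: u = f *: v -> exists w, u = f *: w) ->
  forall u : E, exists v w, u = f *: v + g *: w.
Proof.
move=> freg greg u.
have [D DP] := shift_bound f.
(* [C] is the excess of [size (A (M + D))] over [size (A M)], so [C.+1] powers of [g] suffice for a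
   dependence. It is independent of [M], which can then be chosen to contain these powers applied to
   [u]. *)
set C := (e0 * D)%N.
have [M MP] := level_family (fun i => g ^+ i *: u) C.+1.
have ANb : {in A (M + D), forall t, ~ in_translate t} by move=> t /A_out[].
pose e (i : 'I_(size (A M) + C.+1)) : E := match split i with
  | inl j => f *: to_quot 'X_[nth 0%MM (A M) j]
  | inr j => g ^+ j *: u end.
have [|v v0 vA] := dependence e ANb; first by rewrite !A_size /C; lia.
have coefe i c : outside c -> qcoef c (e i) != 0 -> c \in A (M + D).
  move=> oc; rewrite /e; case: split => j; last by apply: (MP j); rewrite ?leq_addr.
  have [_ cb] := oc; move=> /(qcoefM_neq0 cb)[h [c' [hf [Oc' cb'] c'x cE]]].
  have jA : nth 0%MM (A M) j \in A M by exact: mem_nth.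
  have [OA _] := A_out jA.
  move: c'x; rewrite (qcoef_to_quotX K omega_sub OA) //.
  case: (nth 0%MM (A M) j =P c') => [jc' _|_]; last by rewrite mulr0n eqxx.
  by rewrite jc' in jA; have [|] := DP _ _ _ hf jA; rewrite -cE.
have sum0 : \sum_i to_ring (v 0 i)%:MP *: e i = 0.
  apply: qcoef_ext => c oc; have [_ cb] := oc; rewrite qcoef0 //.
  have [/vA //|cA] := boolP (c \in A (M + D)).
  rewrite qcoef_sum // big1 // => i _; rewrite qcoefC //.
  have [->|/(coefe i c oc)] := eqVneq (qcoef c (e i)) 0; first by rewrite mulr0.
  by rewrite (negPf cA).
move: sum0; rewrite big_split_ord /=.
pose y := \sum_(j < size (A M)) to_ring (v 0 (lshift C.+1 j))%:MP *: to_quot 'X_[nth 0%MM (A M) j].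
rewrite (eq_bigr (fun j => f *: (to_ring (v 0 (lshift C.+1 j))%:MP *: to_quot 'X_[nth 0%MM (A M) j]))); last first.
  by move=> j _; rewrite /e (unsplitK (inl j)) !scalerA mulrC.
rewrite -scaler_sumr -/y.
pose w i := v 0 (rshift (size (A M)) i) .
rewrite (eq_bigr (fun i => to_ring (w i)%:MP *: (g ^+ i *: u))); last first.
  by move=> i _; rewrite /e (unsplitK (inr i)).
move=> fyg.
(* Otherwise the dependence reads [f *: y = 0]; regularity of [f] gives [y = 0], and all its
   coefficients vanish. *)
have [i1 wi1] : exists i, w i != 0.
  apply: contrapT => nex; move/eqP: v0; apply.
  have w0 i : w i = 0 by apply/eqP/negPn/negP => wi; apply: nex; exists i.
  have y0 : y = 0.
    apply: freg; move: fyg; rewrite [X in _ + X]big1 ?addr0 // => i _.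
    by rewrite w0 scale_const0.
  apply/rowP => i; rewrite mxE -(splitK i); case: split => j /=; last exact: w0.
  have jA : nth 0%MM (A M) j \in A M by exact: mem_nth.
  have [OA Ab] := A_out jA.
  have := congr1 (qcoef (nth 0%MM (A M) j)) y0; rewrite qcoef0 // qcoef_sum //.
  rewrite (bigD1 j) //= qcoefC // (qcoef_to_quotX K omega_sub OA) // eqxx mulr1 big1 ?addr0 // => k kj.
  have kA : nth 0%MM (A M) k \in A M by exact: mem_nth.
  have [OA' _] := A_out kA.
  rewrite qcoefC // (qcoef_to_quotX K omega_sub OA') // nth_uniq //.
  by rewrite [_ == _](negPf kj) mulr0.
(* The lowest power of [g] is factored out and cancelled by regularity of [g] modulo [f]; what is
   left solves for [u]. *)
have [i0 wi0 imin] := @arg_minnP _ i1 (fun i => w i != 0) val wi1.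
pose z := \sum_(i < C.+1 | (i0 < i)%N) to_ring (w i)%:MP *: (g ^+ (i - i0).-1 *: u).
have gz : g ^+ i0 *: (to_ring (w i0)%:MP *: u + g *: z) = f *: (- y).
  rewrite scalerN; apply/eqP; rewrite -addr_eq0 addrC -fyg; apply/eqP; congr (_ + _).
  rewrite scalerDr [RHS](bigD1 i0) //= !scalerA mulrC; congr (_ + _).
  rewrite /z scaler_sumr [RHS](bigID (fun i : 'I_C.+1 => (i0 < i)%N)) /=.
  rewrite [X in _ = _ + X]big1 ?addr0 => [|i /andP[ii0 ii]].
    rewrite [RHS](eq_bigl (fun i : 'I_C.+1 => (i0 < i)%N)) => [|i].
      apply: eq_bigr => i ii; rewrite !scalerA; congr (_ *: _).
      have -> : g ^+ i = g ^+ i0 * g * g ^+ (i - i0).-1.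
        by rewrite -exprSr -exprD; congr (g ^+ _); lia.
      by ring.
    by rewrite -val_eqE /=; lia.
  have -> : w i = 0; last by rewrite scale_const0.
  apply/eqP/negPn/negP => /imin /=; move: ii0; rewrite -val_eqE /=; lia.
have div i (x : E) : (exists y : E, g ^+ i *: x = f *: y) -> exists y : E, x = f *: y.
  elim: i => [|i IH] [y' yE]; first by exists y'; rewrite -yE expr0 scale1r.
  by apply: IH; apply: (greg _ y'); rewrite scalerA -exprS.
have [y' yE] := div _ _ (ex_intro _ _ gz).
exists (to_ring (w i0)^-1%:MP *: y'), (- (to_ring (w i0)^-1%:MP *: z)).
rewrite -{1}[u](scale_constK u wi0) -[to_ring (w i0)%:MP *: u](addrK (g *: z)) yE.
by rewrite scalerBr scalerN !scalerA [f * _]mulrC [g * _]mulrC.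
Qed.

End Dimension.

(** * The cone of a plane semigroup *)

Section PlaneCone.
Import Order.TTheory GRing.Theory Num.Theory numFieldNormedType.Exports.
Local Open Scope ring_scope.

Variables (R : realType) (H : submonoid 2) (x1 y1 x2 y2 : nat).
Let a1 := mnm2 x1 y1.
Let a2 := mnm2 x2 y2.
Hypotheses
  (Ha1 : extremal_ray R H a1) (Ha2 : extremal_ray R H a2)
  (x1_gt0 : (0 < x1)%N) (y1_gt0 : (0 < y1)%N) (x2_gt0 : (0 < x2)%N) (y2_gt0 : (0 < y2)%N)
  (det_gt0 : (x2 * y1 < x1 * y2)%N).

Lemma mnm2_0 x y : mnm2 x y ord0 = x. Proof. by []. Qed.
Lemma mnm2_1 x y : mnm2 x y ord_max = y. Proof. by []. Qed.

Lemma ord2P (i : 'I_2) : i = ord0 \/ i = ord_max.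
Proof. by case: i => [[|[|//]] i]; [left|right]; apply: val_inj. Qed.

Lemma rowv2P (v w : 'rV[R]_2) : v 0 ord0 = w 0 ord0 -> v 0 ord_max = w 0 ord_max -> v = w.
Proof. by move=> e0 e1; apply/rowP => i; case: (ord2P i) => ->. Qed.

Let U (v : 'rV[R]_2) : R := x1%:R * v 0 ord_max - y1%:R * v 0 ord0.
Let W (v : 'rV[R]_2) : R := y2%:R * v 0 ord0 - x2%:R * v 0 ord_max.
Let D : R := x1%:R * y2%:R - x2%:R * y1%:R.

Let det_pos : 0 < D.
Proof. by rewrite /D -!natrM subr_gt0 ltr_nat. Qed.

Let v1 := mnm_vec R a1.
Let v2 := mnm_vec R a2.

Let decomp (v : 'rV[R]_2) : v = (W v / D) *: v1 + (U v / D) *: v2.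
Proof.
have D0 : D != 0 by rewrite gt_eqF.
by apply: rowv2P; rewrite !mxE ?mnm2_0 ?mnm2_1 /W /U; move: D0; rewrite /D => D0; field.
Qed.

Let indep s t : 0 < s -> s *: v2 <> t *: v1.
Proof.
move=> s0 /rowP e; have := e ord0; have := e ord_max; rewrite !mxE ?mnm2_0 ?mnm2_1 => e1 e0.
have : s * D = 0.
  transitivity (x1%:R * (s * y2%:R) - (s * x2%:R) * y1%:R); first by rewrite /D; ring.
  by rewrite e1 e0; ring.
by move/eqP; rewrite mulf_eq0 !gt_eqF.
Qed.

Let indep' s t : 0 < s -> s *: v1 <> t *: v2.
Proof.
move=> s0 /rowP e; have := e ord0; have := e ord_max; rewrite !mxE ?mnm2_0 ?mnm2_1 => e1 e0.
have : s * D = 0.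
  transitivity ((s * x1%:R) * y2%:R - (s * y1%:R) * x2%:R); first by rewrite /D; ring.
  by rewrite e1 e0; ring.
by move/eqP; rewrite mulf_eq0 !gt_eqF.
Qed.

(** If [U v < 0], adding a positive multiple of [v2] to [v] lands on the ray of [v1]. Extremality
    then puts that multiple of [v2] on the ray of [v1], against independence. *)
Let functional_ge0 h : H h -> 0 <= U (mnm_vec R h) /\ 0 <= W (mnm_vec R h).
Proof.
move=> Hh; have Ch := cone_mem R Hh; set v := mnm_vec R h.
have [vE h0 h1] : [/\ v = (W v / D) *: v1 + (U v / D) *: v2, 0 <= v 0 ord0 & 0 <= v 0 ord_max].
  by rewrite -decomp !mxE.
have [[H1 _ [_ _ ext1]] [H2 _ [_ _ ext2]]] := (Ha1, Ha2).
have coneZ s a : 0 <= s -> H a -> cone R H (s *: mnm_vec R a).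
  move=> s0 Ha; exists [:: (s, a)]; rewrite big_seq1; split=> // p.
  by rewrite inE => /eqP ->.
have X1 : (0 : R) < x1%:R by rewrite ltr0n.
have X2 : (0 : R) < x2%:R by rewrite ltr0n.
have v0E : v 0 ord0 = W v / D * x1%:R + U v / D * x2%:R by rewrite [in LHS]vE !mxE.
split; rewrite leNgt; apply/negP => neg.
- have s0 : 0 < - (U v / D) by rewrite oppr_gt0 pmulr_llt0 ?invr_gt0.
  (* The first coordinate of [v] is nonnegative while the contribution of [v2] to it is not
     positive. *)
  have t0 : 0 <= W v / D by rewrite -(pmulr_lge0 _ X1); move: h0; rewrite v0E; nra.
  have vs : v + - (U v / D) *: v2 = W v / D *: v1 by rewrite {1}vE scaleNr addrK.
  have [||_ [t _ /esym]] := ext1 v (- (U v / D) *: v2) Ch; last exact: indep.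
    by apply: coneZ => //; exact: ltW.
  by rewrite vs; exists (W v / D).
- have s0 : 0 < - (W v / D) by rewrite oppr_gt0 pmulr_llt0 ?invr_gt0.
  have t0 : 0 <= U v / D by rewrite -(pmulr_lge0 _ X2); move: h0; rewrite v0E; nra.
  have vs : v + - (W v / D) *: v1 = U v / D *: v2.
    by rewrite {1}vE scaleNr addrAC subrr add0r.
  have [||_ [t _ /esym]] := ext2 v (- (W v / D) *: v1) Ch; last exact: indep'.
    by apply: coneZ => //; exact: ltW.
  by rewrite vs; exists (U v / D).
Qed.

Lemma coneP v : cone R H v <-> 0 <= U v /\ 0 <= W v.
Proof.
split=> [[s [sH ->]]|[Uv Wv]].
  have UD a b : U (a + b) = U a + U b by rewrite /U !mxE; ring.
  have WD a b : W (a + b) = W a + W b by rewrite /W !mxE; ring.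
  have UZ k a : U (k *: a) = k * U a by rewrite /U !mxE; ring.
  have WZ k a : W (k *: a) = k * W a by rewrite /W !mxE; ring.
  rewrite big_seq; elim/big_ind: _ => [|a b [] + + []|p /sH[p0 Hp]].
  - by rewrite /U /W !mxE !mulr0 subrr lexx.
  - by move=> aU aW bU bW; split; [rewrite UD|rewrite WD]; apply: addr_ge0.
  - have [p1 p2] := functional_ge0 Hp; split; [rewrite UZ|rewrite WZ]; exact: mulr_ge0.
exists [:: (W v / D, a1); (U v / D, a2)]; split.
  have [[H1 _ _] [H2 _ _]] := (Ha1, Ha2).
  by move=> p; rewrite !inE => /orP[]/eqP -> /=; rewrite divr_ge0 // ltW.
by rewrite !big_cons big_nil addr0 -decomp.
Qed.

(** The cone contains 0, whose weight is free to bring the sum to 1; hence the relative interior is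
    the interior. *)
Let affine_hull_full v : affine_hull (cone R H) v.
Proof.
exists [:: (W v / D, v1); (U v / D, v2); (1 - W v / D - U v / D, 0)]; split.
- have [[H1 _ _] [H2 _ _]] := (Ha1, Ha2).
  by move=> p; rewrite !inE => /or3P[]/eqP -> /=; [exact: cone_mem|exact: cone_mem|exact: cone0].
- by rewrite !big_cons big_nil /=; ring.
- by rewrite !big_cons big_nil /= scaler0 !addr0 -decomp.
Qed.

Lemma omegaP (h : 'X_{1..2}) : semigroup_omega R H h <->
  (y1 * h ord0 < x1 * h ord_max)%N /\ (x2 * h ord_max < y2 * h ord0)%N.
Proof.
set v := mnm_vec R h.
have fun_nat : (0 < U v /\ 0 < W v) <->
    (y1 * h ord0 < x1 * h ord_max)%N /\ (x2 * h ord_max < y2 * h ord0)%N.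
  by rewrite /U /W !mxE -!natrM !subr_gt0 !ltr_nat.
rewrite -fun_nat /semigroup_omega /= /relint /=; split.
  move=> [_ /nbhs_ballP[e /= e0 be]].
  have inC (w : 'rV[R]_2) : (forall i, `|v 0 i - w 0 i| < e) -> 0 <= U w /\ 0 <= W w.
    move=> wv; apply/coneP; apply: be; last exact: affine_hull_full.
    by split=> // i j; rewrite ord1; exact: wv.
  have far x y : exists2 t : R, 0 < t & (t * x%:R < e) && (t * y%:R < e).
    have xy0 : (0 : R) < (x + y + 1)%:R by rewrite ltr0n addn1.
    exists (e / (x + y + 1)%:R); first exact: divr_gt0.
    by rewrite ![e / _ * _]mulrAC !ltr_pdivrMr // !ltr_pM2l // !ltr_nat; lia.
  split.
    (* Moving from [v] against [v2] lowers [U] by [t * D] and must stay in the cone; moving against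
       [v1] does the same for [W]. *)
    have [t t0 /andP[tx ty]] := far x2 y2.
    have [|+ _] := inC (v - t *: v2).
      by move=> i; case: (ord2P i) => ->; rewrite !mxE opprD opprK addNKr ger0_norm ?mulr_ge0 // ltW.
    have -> : U (v - t *: v2) = U v - t * D by rewrite /U /D !mxE ?mnm2_0 ?mnm2_1; ring.
    by rewrite subr_ge0; apply: lt_le_trans; exact: mulr_gt0.
  have [t t0 /andP[tx ty]] := far x1 y1.
  have [|_ +] := inC (v - t *: v1).
    by move=> i; case: (ord2P i) => ->; rewrite !mxE opprD opprK addNKr ger0_norm ?mulr_ge0 // ltW.
  have -> : W (v - t *: v1) = W v - t * D by rewrite /W /D !mxE ?mnm2_0 ?mnm2_1; ring.
  by rewrite subr_ge0; apply: lt_le_trans; exact: mulr_gt0.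
move=> [Uv Wv]; split; first by apply/coneP; rewrite !ltW.
(* In the maximum norm, a move by less than r changes [U] by less than (x1 + y1) r and [W] by less
   than (x2 + y2) r. *)
apply/nbhs_ballP; exists (Num.min (U v / (x1%:R + y1%:R)) (W v / (x2%:R + y2%:R))).
  by rewrite /= lt_min !divr_gt0 // -natrD ltr0n addn_gt0 ?x1_gt0 ?x2_gt0.
move=> w [_ wv] _; apply/coneP.
have := wv 0 ord0; have := wv 0 ord_max; rewrite /ball /= !lt_min.
rewrite !ltr_pdivlMr -?natrD ?ltr0n ?addn_gt0 ?x1_gt0 ?x2_gt0 //.
rewrite !natrD => /andP[d1U d1W] /andP[d0U d0W].
have [Y1 Y2] : 0 < y1%:R :> R /\ 0 < y2%:R :> R by rewrite !ltr0n.
have [X1 X2] : 0 < x1%:R :> R /\ 0 < x2%:R :> R by rewrite !ltr0n.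
have l0 := ler_norm (v 0 ord0 - w 0 ord0); have l0' := ler_norm (- (v 0 ord0 - w 0 ord0)).
have l1 := ler_norm (v 0 ord_max - w 0 ord_max).
have l1' := ler_norm (- (v 0 ord_max - w 0 ord_max)).
rewrite normrN in l0'; rewrite normrN in l1'.
have mean (a c A C S : R) : 0 < a -> 0 < c -> A * (a + c) < S -> C * (a + c) < S ->
    a * A + c * C < S.
  move=> a0 c0 AS CS; rewrite -(ltr_pM2r (addr_gt0 a0 c0)).
  by move: (ltr_pM2l a0 (A * (a + c)) S) (ltr_pM2l c0 (C * (a + c)) S); rewrite AS CS; lra.
split.
  have -> : U w = U v - x1%:R * (v 0 ord_max - w 0 ord_max)
                  + y1%:R * (v 0 ord0 - w 0 ord0) by rewrite /U; ring.
  have := mean _ _ _ _ _ X1 Y1 d1U d0U.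
  by move: (ler_wpM2l (ltW X1) l1) (ler_wpM2l (ltW Y1) l0'); lra.
have -> : W w = W v - y2%:R * (v 0 ord0 - w 0 ord0)
                + x2%:R * (v 0 ord_max - w 0 ord_max) by rewrite /W; ring.
have := mean _ _ _ _ _ X2 Y2 d1W d0W.
by move: (ler_wpM2l (ltW Y2) l0) (ler_wpM2l (ltW X2) l1'); lra.
Qed.

Hypothesis HN2 : normal_affine_semigroup R H.

Lemma semigroupP (h : 'X_{1..2}) : H h <->
  (y1 * h ord0 <= x1 * h ord_max)%N /\ (x2 * h ord_max <= y2 * h ord0)%N.
Proof.
have fun_nat : (0 <= U (mnm_vec R h) /\ 0 <= W (mnm_vec R h)) <->
    (y1 * h ord0 <= x1 * h ord_max)%N /\ (x2 * h ord_max <= y2 * h ord0)%N.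
  by rewrite /U /W !mxE -!natrM !subr_ge0 !ler_nat.
split=> [Hh|/fun_nat/coneP hC]; first by apply/fun_nat/coneP/cone_mem.
have [_ _ HC] := HN2.
have [g Hg gh] : (mnm_vec int @` [set h | H h])%classic (mnm_vec int h).
  rewrite HC /=; congr (cone _ _ _): hC.
  by apply/rowP=> i; rewrite !mxE rmorph_nat.
suff <- : g = h by [].
by apply/mnmP => i; move/rowP/(_ i): gh; rewrite !mxE !natz => -[].
Qed.

End PlaneCone.

(** * Strips along the extremal rays *)

Section Toric.
Import Order.TTheory GRing.Theory Num.Theory.
Local Open Scope ring_scope.

(** The facts about the two linear forms on which the counting rests, symmetric in the two rays so
    that each argument is given for one of them. [toric_sub] replaces subtraction, which exponents
    lack; [toric_mod1] and [toric_mod2] express that the rays are primitive. *)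
Record toric (R : realType) (H : submonoid 2) (u w : 'X_{1..2} -> int)
    (a1 a2 : 'X_{1..2}) (d : int) : Prop := Toric {
  toric_d : 0 < d;
  toric_uD : forall g h, u (g + h)%MM = u g + u h;
  toric_wD : forall g h, w (g + h)%MM = w g + w h;
  toric_inj : forall g h, u g = u h -> w g = w h -> g = h;
  toric_sub : forall c g, u g <= u c -> w g <= w c -> exists h, c = (h + g)%MM;
  toric_H : forall h, H h <-> 0 <= u h /\ 0 <= w h;
  toric_omega : forall h, semigroup_omega R H h <-> 0 < u h /\ 0 < w h;
  toric_a1 : u a1 = 0 /\ w a1 = d;
  toric_a2 : u a2 = d /\ w a2 = 0;
  toric_mod1 : forall g h, u g = u h -> exists k, w g - w h = k * d;
  toric_mod2 : forall g h, w g = w h -> exists k, u g - u h = k * d;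
  toric_level1 : forall j : nat, (0 < j)%N -> exists p, u p = j /\ 0 < w p <= d;
  toric_level2 : forall j : nat, (0 < j)%N -> exists p, w p = j /\ 0 < u p <= d }.

Lemma toric_sym R H u w a1 a2 d : toric R H u w a1 a2 d -> toric R H w u a2 a1 d.
Proof.
case=> d0 uD wD inj sub tH tO [ua1 wa1] [ua2 wa2] m1 m2 l1 l2; split=> //.
- by move=> g h wg ug; exact: inj.
- by move=> c g wc uc; exact: sub.
- by move=> h; rewrite tH; tauto.
- by move=> h; rewrite tO; tauto.
Qed.

(** The offset [s] allows a strip to start beyond the points that it shares with the strip along the
    other ray. *)
Definition strip (p : nat -> 'X_{1..2}) (a : 'X_{1..2}) (cnt s m : nat) :=
  [seq (p j + a *+ n)%MM | j <- iota 1 cnt, n <- iota s m].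

Lemma size_strip p a cnt s m : size (strip p a cnt s m) = (cnt * m)%N.
Proof. by rewrite size_allpairs !size_iota. Qed.

Lemma stripP p a cnt s m c : reflect (exists j n,
  [/\ (0 < j <= cnt)%N, (s <= n < s + m)%N & c = (p j + a *+ n)%MM])
  (c \in strip p a cnt s m).
Proof.
apply: (iffP allpairsP) => [[[j n] /= []]|[j [n [jc nm ->]]]].
  by rewrite !mem_iota => jc nm ->; exists j, n; split=> //; lia.
by exists (j, n); rewrite !mem_iota; split=> //=; lia.
Qed.

Section Basic.
Variables (R : realType) (H : submonoid 2) (u w : 'X_{1..2} -> int)
  (a1 a2 : 'X_{1..2}) (d : int).
Hypothesis T : toric R H u w a1 a2 d.
Local Notation Om := (semigroup_omega R H).

Lemma toric_omega_sub h : Om h -> H h.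
Proof. by move=> /(toric_omega T)[u0 w0]; apply/(toric_H T); lia. Qed.

Lemma toric_u0 : u 0%MM = 0.
Proof. by have := toric_uD T 0%MM 0%MM; rewrite addm0; lia. Qed.

Lemma toric_w0 : w 0%MM = 0.
Proof. by have := toric_wD T 0%MM 0%MM; rewrite addm0; lia. Qed.

Lemma toric_uMn h k : u (h *+ k)%MM = u h * k%:Z.
Proof.
elim: k => [|k IH]; first by rewrite mulm0n toric_u0 mulr0.
by rewrite mulmS (toric_uD T) IH; lia.
Qed.

Lemma toric_wMn h k : w (h *+ k)%MM = w h * k%:Z.
Proof.
elim: k => [|k IH]; first by rewrite mulm0n toric_w0 mulr0.
by rewrite mulmS (toric_wD T) IH; lia.
Qed.

Lemma toric_subH c g : u g <= u c -> w g <= w c -> exists2 h, H h & c = (h + g)%MM.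
Proof.
move=> uc wc; have [h hE] := toric_sub T uc wc; exists h => //; apply/(toric_H T).
by move: uc wc; rewrite hE (toric_uD T) (toric_wD T); lia.
Qed.

Lemma toric_in_translate b c : in_translate H b c <-> u b <= u c /\ w b <= w c.
Proof.
split=> [[h /(toric_H T)[u0 w0] ->]|[uc wc]].
  by rewrite (toric_uD T) (toric_wD T); lia.
by have [h Hh ->] := toric_subH uc wc; exists h; rewrite // addmC.
Qed.

Lemma toric_outside b c : outside R H b c <-> [/\ 0 < u c, 0 < w c & u c < u b \/ w c < w b].
Proof.
rewrite /outside (toric_omega T) toric_in_translate.
by split=> [[[u0 w0]] nb|[u0 w0 ub]]; [split=> //; lia|split; lia].
Qed.

Lemma toric_ray h : H h -> u h = 0 -> exists k, h = (a1 *+ k)%MM.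
Proof.
move=> /(toric_H T)[_ w0] u0; have [ua wa] := toric_a1 T; have d0 := toric_d T.
have [|k kE] := toric_mod1 T (g := h) (h := 0%MM); first by rewrite toric_u0.
rewrite toric_w0 subr0 in kE; have k0 : 0 <= k by nia.
exists `|k|%N; apply: (toric_inj T); first by rewrite toric_uMn ua u0 mul0r.
by rewrite toric_wMn wa kE; lia.
Qed.

Lemma toric_neq0 h : H h -> h != 0%MM -> 0 < u h \/ d <= w h.
Proof.
move=> Hh h0; have [u0 w0] := (toric_H T h).1 Hh; have [ua wa] := toric_a1 T.
have [uh|] : u h = 0 \/ 0 < u h by lia.
  have [k hE] := toric_ray Hh uh; right; have d0 := toric_d T.
  have kn : k <> 0%N by move=> k0; move: h0; rewrite hE k0 mulm0n eqxx.
  by rewrite hE toric_wMn wa; nia.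
by left.
Qed.

Variable p : nat -> 'X_{1..2}.
Hypothesis pP : forall j, (0 < j)%N -> u (p j) = j /\ 0 < w (p j) <= d.

Lemma strip_uw j n : (0 < j)%N ->
  u (p j + a1 *+ n)%MM = j /\ w (p j + a1 *+ n)%MM = w (p j) + n%:Z * d.
Proof.
move=> j0; have [ua wa] := toric_a1 T; have [uj _] := pP j0.
by rewrite (toric_uD T) (toric_wD T) toric_uMn toric_wMn ua wa uj; split; ring.
Qed.

Lemma strip_level c (j : nat) : (0 < j)%N -> u c = j -> 0 < w c ->
  exists n, c = (p j + a1 *+ n)%MM.
Proof.
move=> j0 uc wc; have [uj wj] := pP j0; have d0 := toric_d T.
have [|k kE] := toric_mod1 T (g := c) (h := p j); first by rewrite uc uj.
have k0 : 0 <= k by nia.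
exists `|k|%N; have [us ws] := strip_uw `|k|%N j0.
by apply: (toric_inj T); rewrite ?us ?ws //; lia.
Qed.

Lemma mem_strip cnt m c :
  c \in strip p a1 cnt 0 m <-> [/\ 0 < u c, 0 < w c, u c <= cnt%:Z & w c <= m%:Z * d].
Proof.
have d0 := toric_d T; split=> [/stripP[j [n [jc nm ->]]]|[u0 w0 uc wc]].
  have j0 : (0 < j)%N by lia.
  have [-> ->] := strip_uw n j0; have [_ /andP[w0 wd]] := pP j0.
  have nm' : n%:Z + 1 <= m by lia.
  by split; [lia|nia|lia|nia].
have j0 : (0 < `|u c|)%N by lia.
have [|n cE] := strip_level j0 _ w0; first by lia.
apply/stripP; exists `|u c|%N, n; split=> //; first by lia.
have [_ wE] := strip_uw n j0; have [_ /andP[pw _]] := pP j0.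
have : (n%:Z < m%:Z); last by lia.
by rewrite cE wE in wc; nia.
Qed.

Lemma strip_inj i j n m : (0 < i)%N -> (0 < j)%N ->
  (p i + a1 *+ n = p j + a1 *+ m)%MM -> i = j /\ n = m.
Proof.
move=> i0 j0 E; have [ui wi] := strip_uw n i0; have [uj wj] := strip_uw m j0.
have ij : i = j by rewrite E uj in ui; lia.
split=> //; have d0 := toric_d T; rewrite E wj ij in wi.
suff : (n%:Z = m%:Z) by lia.
by nia.
Qed.

Lemma strip_uniq cnt s m : uniq (strip p a1 cnt s m).
Proof.
apply: allpairs_uniq; rewrite ?iota_uniq // => -[i n] [j k].
move=> /allpairsP[[i' n'] /= [+ _ [-> ->]]] /allpairsP[[j' k'] /= [+ _ [-> ->]]].
rewrite !mem_iota => i0 j0 /strip_inj; case; [lia|lia|by move=> -> ->].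
Qed.

End Basic.

Section Levels.
Variables (R : realType) (H : submonoid 2) (u w : 'X_{1..2} -> int)
  (a1 a2 : 'X_{1..2}) (d : int) (b : 'X_{1..2}) (p q : nat -> 'X_{1..2}).
Hypothesis T : toric R H u w a1 a2 d.
Hypothesis pP : forall j, (0 < j)%N -> u (p j) = j /\ 0 < w (p j) <= d.
Hypothesis qP : forall j, (0 < j)%N -> w (q j) = j /\ 0 < u (q j) <= d.
Hypothesis bO : semigroup_omega R H b.
Let T' := toric_sym T.

Definition strip_mult := (`|u b|.-1 + `|w b|.-1)%N.

Definition levels s m := strip p a1 `|u b|.-1 s m ++ strip q a2 `|w b|.-1 s m.

Lemma size_levels s m : size (levels s m) = (strip_mult * m)%N.
Proof. by rewrite size_cat !size_strip mulnDl. Qed.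

Lemma mem_levels m c : c \in levels 0 m <->
  [/\ 0 < u c, 0 < w c & (u c < u b /\ w c <= m%:Z * d) \/ (w c < w b /\ u c <= m%:Z * d)].
Proof.
have [ub wb] := (toric_omega T b).1 bO.
have := mem_strip T pP `|u b|.-1 m c; have := mem_strip T' qP `|w b|.-1 m c.
rewrite mem_cat => q_iff p_iff; split=> [/orP[/p_iff|/q_iff]|].
- by case=> *; split=> //; left; lia.
- by case=> *; split=> //; right; lia.
case=> u0 w0 [[uc wc]|[wc uc]]; apply/orP; [left; apply/p_iff|right; apply/q_iff].
  by split=> //; lia.
by split=> //; lia.
Qed.

Lemma levels_outside s m : {in levels s m, forall c, outside R H b c}.
Proof.
have [ub wb] := (toric_omega T b).1 bO; have d0 := toric_d T.
move=> c; rewrite mem_cat => /orP[] /stripP[j [n [jc nm ->]]]; apply/(toric_outside T).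
  have j0 : (0 < j)%N by lia.
  have [-> ->] := strip_uw T pP n j0; have [_ /andP[w0 _]] := pP j0.
  by split; [lia|nia|left; lia].
have j0 : (0 < j)%N by lia.
have [-> ->] := strip_uw T' qP n j0; have [_ /andP[w0 _]] := qP j0.
by split; [nia|lia|right; lia].
Qed.

Lemma levels_uniq s m :
    (forall c, c \in levels s m -> u c < u b -> w c < w b -> False) ->
  uniq (levels s m).
Proof.
have [ub wb] := (toric_omega T b).1 bO.
move=> disj; rewrite cat_uniq (strip_uniq T pP) (strip_uniq T' qP) andbT /=.
apply/hasPn => c cq; apply/negP => cp; apply: (disj c).
- by rewrite mem_cat cp.
- move/stripP: cp => [j [n [jc _ ->]]]; have j0 : (0 < j)%N by lia.
  by have [-> _] := strip_uw T pP n j0; lia.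
move/stripP: cq => [j [n [jc _ ->]]]; have j0 : (0 < j)%N by lia.
by have [-> _] := strip_uw T' qP n j0; lia.
Qed.

Lemma outside_strip c : outside R H b c -> (exists j n, (0 < j < `|u b|)%N /\ c = (p j + a1 *+ n)%MM)
  \/ (exists j n, (0 < j < `|w b|)%N /\ c = (q j + a2 *+ n)%MM).
Proof.
move=> /(toric_outside T)[u0 w0 [ub|wb]]; [left|right].
  have j0 : (0 < `|u c|)%N by lia.
  have [|n cE] := strip_level T pP j0 _ w0; first by lia.
  by exists `|u c|%N, n; split=> //; lia.
have j0 : (0 < `|w c|)%N by lia.
have [|n cE] := strip_level T' qP j0 _ u0; first by lia.
by exists `|w c|%N, n; split=> //; lia.
Qed.

End Levels.
End Toric.

(** * Ulrich elements *)

Section Ulrich.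
Import Order.TTheory GRing.Theory Num.Theory.
Local Open Scope ring_scope.

(** The product of the [Q - m] for [m <= B] vanishes at all large integers, so it is zero and one of
    its factors is. *)
Lemma poly_bounded_nat (Q : {poly rat}) (k0 B : nat) :
    (forall k, (k0 <= k)%N -> exists2 m : nat, (m <= B)%N & Q.[k%:R] = m%:R) ->
  (size Q <= 1)%N.
Proof.
move=> Qm; pose P := \prod_(m < B.+1) (Q - (m%:R)%:P).
have P0 : P = 0.
  apply/eqP/negPn/negP => Pn0.
  pose rs : seq rat := [seq i%:R | i <- iota k0 (size P)].
  have rsP : all (root P) rs.
    apply/allP => x /mapP[k]; rewrite mem_iota => /andP[kk _] ->.
    have [m mB Qk] := Qm k kk; rewrite rootE horner_prod.
    have mB' : (m < B.+1)%N by [].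
    by rewrite (bigD1 (Ordinal mB')) //= !hornerE Qk subrr mul0r.
  have rsU : uniq rs by rewrite map_inj_uniq ?iota_uniq // => i j /eqP; rewrite eqr_nat => /eqP.
  by have := max_poly_roots Pn0 rsP rsU; rewrite size_map size_iota ltnn.
have /eqP : P = 0 := P0; rewrite /P prodf_seq_eq0 => /hasP[m _].
by rewrite /= subr_eq0 => /eqP ->; exact: size_polyC_leq1.
Qed.

Variables (R : realType) (K : fieldType) (H : submonoid 2).
Local Notation Om := (semigroup_omega R H).
Local Notation KH := (semigroup_ring K H).
Local Notation mmax := (graded_max_ideal K H).

(** The weight [w + d * u] is at least [d] on a nonzero element of [H]: either [u] is at least 1, or
    the element is a positive multiple of [a1]. *)
Lemma omega_pow_weight (u w : 'X_{1..2} -> int) a1 a2 d k c :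
  toric R H u w a1 a2 d -> omega_pow R H k c -> k%:Z * d <= w c + d * u c.
Proof.
move=> T; have d0 := toric_d T; elim: k c => [|k IH] c /=.
  by move=> /(toric_omega T)[]; nia.
move=> [h [c' [Hh h0 /IH kc ->]]]; rewrite (toric_uD T) (toric_wD T).
by have [uh wh] := (toric_H T h).1 Hh; case: (toric_neq0 T Hh h0); nia.
Qed.

Section Data.
Variables (u w : 'X_{1..2} -> int)
  (a1 a2 : 'X_{1..2}) (d : int) (b : 'X_{1..2}) (p q : nat -> 'X_{1..2}).
Hypothesis T : toric R H u w a1 a2 d.
Hypothesis pP : forall j, (0 < j)%N -> u (p j) = j /\ 0 < w (p j) <= d.
Hypothesis qP : forall j, (0 < j)%N -> w (q j) = j /\ 0 < u (q j) <= d.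
Hypothesis bO : Om b.
Local Notation E := (omega_quotient R K H b).
Local Notation strip_mult := (strip_mult u w b).
Local Notation levels := (levels u w a1 a2 b p q).
Let T' := toric_sym T.
Let omega_sub := toric_omega_sub T.

(** Such a point is [p j + a1 *+ n] or [q j + a2 *+ n] with [n >= k], and so splits off [k] copies
    of a ray vector. *)
Lemma notin_levels_pow k c : outside R H b c -> c \notin levels 0 k -> omega_pow R H k c.
Proof.
have [ub wb] := (toric_omega T b).1 bO; have d0 := toric_d T.
have [[ua1 wa1] [ua2 wa2]] := (toric_a1 T, toric_a2 T).
have Ha1 : H a1 by apply/(toric_H T); lia.
have Ha2 : H a2 by apply/(toric_H T); lia.
have a10 : a1 != 0%MM by apply/eqP => a0; move: wa1; rewrite a0 (toric_w0 T); lia.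
have a20 : a2 != 0%MM by apply/eqP => a0; move: ua2; rewrite a0 (toric_u0 T); lia.
move=> oc /negP ck.
have pow1 : forall n j, (0 < j)%N -> omega_pow R H n (p j + a1 *+ n)%MM.
  elim=> [|n IH] j j0 /=.
    by apply/(toric_omega T); have [-> ->] := strip_uw T pP 0 j0; have := pP j0; lia.
  exists a1, (p j + a1 *+ n)%MM; split=> //; first exact: IH.
  by rewrite mulmS addmA [(p j + a1)%MM]addmC -addmA.
have pow2 : forall n j, (0 < j)%N -> omega_pow R H n (q j + a2 *+ n)%MM.
  elim=> [|n IH] j j0 /=.
    by apply/(toric_omega T); have [-> ->] := strip_uw T' qP 0 j0; have := qP j0; lia.
  exists a2, (q j + a2 *+ n)%MM; split=> //; first exact: IH.
  by rewrite mulmS addmA [(q j + a2)%MM]addmC -addmA.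
have split_mul (a : 'X_{1..2}) n : (k <= n)%N -> (a *+ n = a *+ (n - k) + a *+ k)%MM.
  by move=> kn; apply/mnmP => i; rewrite mnmDE !mulmnE -mulnDr subnK.
have [[j [n [jb cE]]]|[j [n [jb cE]]]] := outside_strip T pP qP oc.
  have j0 : (0 < j)%N by lia.
  have kn : (k <= n)%N.
    rewrite leqNgt; apply/negP => nk; apply: ck; rewrite mem_cat; apply/orP; left.
    by apply/stripP; exists j, n; split=> //; lia.
  rewrite cE split_mul // addmA [(p j + _)%MM]addmC -addmA; apply: omega_pow_up; last exact: pow1.
  exact: submonoidMn.
have j0 : (0 < j)%N by lia.
have kn : (k <= n)%N.
  rewrite leqNgt; apply/negP => nk; apply: ck; rewrite mem_cat; apply/orP; right.
  by apply/stripP; exists j, n; split=> //; lia.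
rewrite cE split_mul // addmA [(q j + _)%MM]addmC -addmA; apply: omega_pow_up; last exact: pow2.
exact: submonoidMn.
Qed.

Lemma omega_length_bounds : exists C : nat, forall k l,
  quotient_length (ideal_pow_mul mmax (E := E) k) l ->
  (strip_mult * (k - C) <= l)%N /\ (l <= strip_mult * k)%N.
Proof.
have [ub wb] := (toric_omega T b).1 bO; have d0 := toric_d T.
(* One copy of [|u b| + |w b|] is the offset that separates the two strips. The rest keeps
   [n + j + 2 <= k], so that by weight the points stay out of m^k omega. *)
exists (2 * (`|u b| + `|w b|) + 1)%N => k l [[L [L0 Lch]] lmax]; split; last first.
  rewrite -(size_levels u w a1 a2 b p q 0).
  apply: chain_le Lch => [t /(levels_outside T pP qP bO)[]//|x xT|]; last exact: L0.
  rewrite (ideal_pow_mulE K b omega_sub) => c oc cx; apply: notin_levels_pow => //.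
  by apply: contraNN cx => /xT ->.
apply: leq_trans (lmax (size (levels (`|u b| + `|w b|) (k - (2 * (`|u b| + `|w b|) + 1)))) _).
  by rewrite size_levels.
have low c : c \in levels (`|u b| + `|w b|) (k - (2 * (`|u b| + `|w b|) + 1)) ->
    ~ omega_pow R H k c /\ (u b <= u c \/ w b <= w c).
  rewrite mem_cat => /orP[] /stripP[j [n [jb nk cE]]]; have j0 : (0 < j)%N by lia.
    have [uE wE] := strip_uw T pP n j0; have [_ wj] := pP j0; rewrite -cE in uE wE.
    split; last by right; rewrite wE; nia.
    move=> /(omega_pow_weight T); rewrite uE wE => kd.
    have : (k%:Z < n%:Z + j%:Z + 2)%R; last by lia.
    by rewrite -(ltr_pM2r d0); lia.
  have [uE wE] := strip_uw T' qP n j0; have [_ wj] := qP j0; rewrite -cE in uE wE.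
  split; last by left; rewrite wE; nia.
  move=> /(omega_pow_weight T'); rewrite uE wE => kd.
  have : (k%:Z < n%:Z + j%:Z + 2)%R; last by lia.
  by rewrite -(ltr_pM2r d0); lia.
have := @chain_ge R K _ H b omega_sub (omega_pow R H k)
  (levels (`|u b| + `|w b|) (k - (2 * (`|u b| + `|w b|) + 1))).
case.
- by move=> h c Hh; exact: omega_pow_up.
- by apply: (levels_uniq T pP qP bO) => c /low[_]; lia.
- by move=> t tl; split; [exact: (levels_outside T pP qP bO tl)|have [] := low _ tl].
by move=> L' [L'0 L'ch]; exists L'; rewrite (ideal_pow_mulE K b omega_sub).
Qed.

(** A Hilbert-Samuel polynomial at bounded distance from [mu * X] differs from it by a constant; as
    [mu > 0], its degree is 1 and its leading coefficient [mu]. *)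
Lemma multiplicity_eq e : (0 < strip_mult)%N -> multiplicity mmax E e -> e = strip_mult.
Proof.
move=> m0 [dm [P [_ sP lP [k0 kP]]]]; have [C bd] := omega_length_bounds.
move: (strip_mult) m0 bd => mu m0 bd.
(* The shift by [mu * C] makes the values natural numbers; the upper bound [mu * C.+1] reflects that
   P at k is the length for m^(k+1). *)
pose Q := P - mu%:R *: 'X + ((mu * C)%:R)%:P.
have sQ : (size Q <= 1)%N.
  apply: (@poly_bounded_nat _ k0 (mu * C.+1)) => k /kP[l /bd[lo hi] Pk].
  exists (l + mu * C - mu * k)%N; first by nia.
  rewrite !hornerE Pk natrB; last by nia.
  by rewrite !natrD !natrM; ring.
have PE : P = mu%:R *: 'X + (Q`_0 - (mu * C)%:R)%:P.
  by rewrite polyCB -(size1_polyC sQ) /Q; ring.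
have sX : size (mu%:R *: 'X : {poly rat}) = 2%N.
  by rewrite size_scale ?size_polyX // pnatr_eq0 -lt0n.
have lt : (size (Q`_0 - (mu * C)%:R)%:P < size (mu%:R *: 'X : {poly rat}))%N.
  by rewrite sX ltnS size_polyC_leq1.
have d1 : dm = 1%N by move: sP; rewrite PE size_polyDl // sX; lia.
move: lP; rewrite PE lead_coefDl // lead_coefZ lead_coefX mulr1 d1 divr1.
by move/eqP; rewrite eqr_nat => /eqP.
Qed.

Lemma min_num_gens_lt k i j : (0 < i < j)%N -> (j < `|u b|)%N -> w (p i) <= w (p j) ->
  min_num_gens E k -> (k < strip_mult)%N.
Proof.
move=> ij jb wij [_ kmin].
have [i0 j0] : (0 < i)%N /\ (0 < j)%N by lia.
have [[ui wi] [uj wj]] := (pP i0, pP j0).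
pose G := [seq c <- levels 0 1 | c != p j].
have Gk : (size G < strip_mult)%N.
  rewrite -[strip_mult]muln1 -(size_levels u w a1 a2 b p q 0) size_filter -(count_predC (pred1 (p j))).
  rewrite -[X in (X < _)%N]add0n ltn_add2r -has_count; apply/hasP; exists (p j) => //=.
  rewrite mem_cat; apply/orP; left; apply/stripP; exists j, 0%N.
  by rewrite mulm0n addm0; split=> //; lia.
apply: leq_ltn_trans Gk; apply: kmin.
apply: (gens_le K omega_sub) => [g|c oc].
  by rewrite mem_filter => /andP[_ /(levels_outside T pP qP bO)[]].
have gen g h : H h -> c = (h + g)%MM -> g \in levels 0 1 ->
    exists h g, [/\ H h, g \in G & c = (h + g)%MM].
  move=> Hh cE gl; have [gE|gj] := eqVneq g (p j); last first.
    by exists h, g; split=> //; rewrite mem_filter gj.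
  have [|//|h' Hh' h'E] := toric_subH T (c := p j) (g := p i); first by lia.
  exists (h + h')%MM, (p i); split; [exact: submonoidD| |by rewrite cE gE h'E addmA].
  rewrite mem_filter; apply/andP; split; first by apply/eqP => pij; move: ui; rewrite pij; lia.
  rewrite mem_cat; apply/orP; left; apply/stripP; exists i, 0%N.
  by rewrite mulm0n addm0; split=> //; lia.
have [[ua1 wa1] [ua2 wa2]] := (toric_a1 T, toric_a2 T); have d0 := toric_d T.
have Ha1 : H a1 by apply/(toric_H T); lia.
have Ha2 : H a2 by apply/(toric_H T); lia.
have [[k' [n [kb cE]]]|[k' [n [kb cE]]]] := outside_strip T pP qP oc.
  apply: (gen (p k') (a1 *+ n)%MM); [exact: submonoidMn|by rewrite cE addmC|].
  rewrite mem_cat; apply/orP; left; apply/stripP; exists k', 0%N.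
  by rewrite mulm0n addm0; split=> //; lia.
apply: (gen (q k') (a2 *+ n)%MM); [exact: submonoidMn|by rewrite cE addmC|].
rewrite mem_cat; apply/orP; right; apply/stripP; exists k', 0%N.
by rewrite mulm0n addm0; split=> //; lia.
Qed.

(* An Ulrich quotient needs as many generators as the multiplicity predicts, so
   no generator [p j] may be redundant. *)
Lemma ulrich_decreasing i j : ulrich mmax E -> (0 < i < j)%N -> (j < `|u b|)%N ->
  w (p j) < w (p i).
Proof.
move=> U ij jb; rewrite ltNge; apply/negP => wij.
have m0 : (0 < strip_mult)%N by rewrite /strip_mult; lia.
case: U => [E0|[_ [k kg km]]].
  have j0 : (0 < j)%N by lia.
  have [uj wj] := pP j0.
  have [ub wb] := (toric_omega T b).1 bO.
  have [Oj jb'] : outside R H b (p j) by apply/(toric_outside T); split; lia.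
  have := qcoef_to_quotX K omega_sub Oj jb'; rewrite (E0 (to_quot R H b 'X_[p j])) eqxx qcoef0 // => /eqP.
  by rewrite eq_sym oner_eq0.
have := min_num_gens_lt ij jb wij kg; rewrite (multiplicity_eq m0 km); lia.
Qed.

End Data.
End Ulrich.

(** * Sufficiency: decreasing sequences of generators give an Ulrich quotient *)

Section Good.
Import Order.TTheory GRing.Theory Num.Theory.
Local Open Scope ring_scope.

Variables (R : realType) (K : fieldType) (H : submonoid 2).
Local Notation Om := (semigroup_omega R H).
Local Notation KH := (semigroup_ring K H).
Local Notation mmax := (graded_max_ideal K H).

(** Adding a nonzero [h] raises [n] in [p j + a1 *+ n]. If [u h = 0], then [w] grows by at least [d]
    on the same line; otherwise [j] grows and [w (p j)] drops, while [w] of the point does not, so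
    [n] must grow. *)
Lemma strip_climb (u w : 'X_{1..2} -> int) a1 a2 d b p :
    toric R H u w a1 a2 d ->
    (forall j, (0 < j)%N -> u (p j) = j /\ 0 < w (p j) <= d) ->
    (forall i j, (0 < i < j)%N -> (j < `|u b|)%N -> w (p j) < w (p i)) ->
  forall (k : nat) h c, H h -> h != 0%MM -> Om c -> u (h + c)%MM < u b ->
    k%:Z * d < w c -> (k%:Z + 1) * d < w (h + c)%MM.
Proof.
move=> T pP dec k h c Hh h0 /(toric_omega T)[uc wc] uhc kw.
have d0 := toric_d T; have [uh wh] := (toric_H T h).1 Hh.
have E := toric_uD T h c; have E' := toric_wD T h c.
have jc : (0 < `|u c|)%N by lia.
have jhc : (0 < `|u (h + c)%MM|)%N by lia.
have [|n cE] := strip_level T pP jc _ wc; first by lia.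
have [||m hcE] := strip_level T pP jhc (c := (h + c)%MM); [lia|lia|].
have [_ wcE] := strip_uw T pP n jc; have [_ whcE] := strip_uw T pP m jhc.
rewrite -cE in wcE; rewrite -hcE in whcE.
have [[_ /andP[wp wpd]] [_ /andP[wp' wpd']]] := (pP _ jc, pP _ jhc).
have kn : (k%:Z < n%:Z + 1) by rewrite -(ltr_pM2r d0); lia.
have nm : n%:Z < m%:Z.
  have [uh0|uh0] : u h = 0 \/ 0 < u h by lia.
    have e : `|u (h + c)%MM|%N = `|u c|%N by lia.
    rewrite e in whcE; have [|wd] := toric_neq0 T Hh h0; first by lia.
    by rewrite -(ltr_pM2r d0); lia.
  have ww : w (p `|u (h + c)%MM|%N) < w (p `|u c|%N) by apply: dec; lia.
  by rewrite -(ltr_pM2r d0); lia.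
have : (k%:Z + 1) * d <= m%:Z * d by rewrite ler_pM2r //; lia.
by lia.
Qed.

Variables (u w : 'X_{1..2} -> int)
  (a1 a2 : 'X_{1..2}) (d : int) (b : 'X_{1..2}) (p q : nat -> 'X_{1..2}).
Hypothesis T : toric R H u w a1 a2 d.
Hypothesis pP : forall j, (0 < j)%N -> u (p j) = j /\ 0 < w (p j) <= d.
Hypothesis qP : forall j, (0 < j)%N -> w (q j) = j /\ 0 < u (q j) <= d.
Hypothesis bO : Om b.
Hypothesis disj : forall c, Om c -> u c < u b -> w c < w b -> False.
Hypothesis pdec : forall i j, (0 < i < j)%N -> (j < `|u b|)%N -> w (p j) < w (p i).
Hypothesis qdec : forall i j, (0 < i < j)%N -> (j < `|w b|)%N -> u (q j) < u (q i).
Hypotheses (ubd : u b <= d) (wbd : w b <= d).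
Local Notation E := (omega_quotient R K H b).
Local Notation strip_mult := (strip_mult u w b).
Local Notation levels := (levels u w a1 a2 b p q).
Let T' := toric_sym T.
Let omega_sub := toric_omega_sub T.
Let d0 := toric_d T.

Let levelsP m c := mem_levels T pP qP bO m c.

(** The converse of [notin_levels_pow]; the monotonicity of both sequences enters here, each nonzero
    summand climbing one level. *)
Lemma pow_notin_levels k c : outside R H b c -> omega_pow R H k c -> c \notin levels 0 k.
Proof.
elim: k c => [|k IH] c oc.
  move=> _; apply/negP => /levelsP[u0 w0]; lia.
move=> [h [c' [Hh h0 c'k cE]]]; apply/negP => /levelsP[u0 w0 lev].
have Oc' := omega_pow_omega c'k; have [u0' w0'] := (toric_omega T c').1 Oc'.
have [uh wh] := (toric_H T h).1 Hh.
have [E1 E2] : u c = u h + u c' /\ w c = w h + w c' by rewrite cE (toric_uD T) (toric_wD T).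
have oc' : outside R H b c' by apply/(toric_outside T); split=> //; lia.
have /negP c'l := IH _ oc' c'k; rewrite (_ : k.+1%:Z = k%:Z + 1) in lev; last by lia.
case: lev => -[lt le].
  have : k%:Z * d < w c'.
    by rewrite ltNge; apply/negP => wk; apply: c'l; apply/levelsP; split=> //; left; lia.
  by move/(strip_climb T pP pdec Hh h0 Oc'); rewrite -cE => /(_ lt); lia.
have : k%:Z * d < u c'.
  by rewrite ltNge; apply/negP => wk; apply: c'l; apply/levelsP; split=> //; right; lia.
by move/(strip_climb T' qP qdec Hh h0 Oc'); rewrite -cE => /(_ lt); lia.
Qed.

Lemma levels_uniq0 m : uniq (levels 0 m).
Proof.
by apply: (levels_uniq T pP qP bO) => c /(levels_outside T pP qP bO)[Oc _]; exact: disj.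
Qed.

Lemma good_length k : quotient_length (ideal_pow_mul mmax (E := E) k) (strip_mult * k)%N.
Proof.
rewrite -(size_levels u w a1 a2 b p q 0) (ideal_pow_mulE K b omega_sub); split.
  apply: (chain_ge K omega_sub).
  - by move=> h c Hh; exact: omega_pow_up.
  - exact: levels_uniq0.
  - move=> t tl; have ot := levels_outside T pP qP bO tl; split=> // /(pow_notin_levels ot).
    by rewrite tl.
move=> j [L [L0 Lch]].
apply: chain_le Lch => [t /(levels_outside T pP qP bO)[]//|x xT|]; last exact: L0.
move=> c oc cx; apply: (notin_levels_pow T pP qP bO) => //.
by apply: contraNN cx => /xT ->.
Qed.

Let gen_minimal g : g \in levels 0 1 ->
  forall h c, H h -> Om c -> g = (h + c)%MM -> h = 0%MM.
Proof.
move=> gl h c Hh Oc gE; apply/eqP/negPn/negP => h0.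
suff /(pow_notin_levels (levels_outside T pP qP bO gl)) : omega_pow R H 1 g by rewrite gl.
by exists h, c.
Qed.

Lemma good_min_num_gens : min_num_gens E strip_mult.
Proof.
split.
  rewrite -[strip_mult]muln1 -(size_levels u w a1 a2 b p q 0).
  apply: (gens_le K omega_sub) => [g /(levels_outside T pP qP bO)[]//|c oc].
  have [[ua1 wa1] [ua2 wa2]] := (toric_a1 T, toric_a2 T).
  have Ha1 : H a1 by apply/(toric_H T); lia.
  have Ha2 : H a2 by apply/(toric_H T); lia.
  have [[k' [n [kb cE]]]|[k' [n [kb cE]]]] := outside_strip T pP qP oc.
    exists (a1 *+ n)%MM, (p k'); split; [exact: submonoidMn| |by rewrite cE addmC].
    rewrite mem_cat; apply/orP; left; apply/stripP; exists k', 0%N.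
    by rewrite mulm0n addm0; split=> //; lia.
  exists (a2 *+ n)%MM, (q k'); split; [exact: submonoidMn| |by rewrite cE addmC].
  rewrite mem_cat; apply/orP; right; apply/stripP; exists k', 0%N.
  by rewrite mulm0n addm0; split=> //; lia.
move=> k [s [<- sgen]]; rewrite -[strip_mult]muln1 -(size_levels u w a1 a2 b p q 0).
apply: (gens_ge omega_sub _ _ _ sgen) => [|g /(levels_outside T pP qP bO)//|g].
  exact: levels_uniq0.
exact: gen_minimal.
Qed.

Let a1_neq0 : a1 != 0%MM.
Proof. by apply/eqP => a0; have [_] := toric_a1 T; rewrite a0 (toric_w0 T); lia. Qed.
Let a2_neq0 : a2 != 0%MM.
Proof. by apply/eqP => a0; have [+ _] := toric_a2 T; rewrite a0 (toric_u0 T); lia. Qed.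
Let Ha1 : H a1. Proof. by have [? ?] := toric_a1 T; apply/(toric_H T); lia. Qed.
Let Ha2 : H a2. Proof. by have [? ?] := toric_a2 T; apply/(toric_H T); lia. Qed.

Let uD g h : H g -> H h -> `|u (g + h)%MM|%N = (`|u g| + `|u h|)%N.
Proof. by move=> /(toric_H T)[? ?] /(toric_H T)[? ?]; rewrite (toric_uD T); lia. Qed.
Let wD g h : H g -> H h -> `|w (g + h)%MM|%N = (`|w g| + `|w h|)%N.
Proof. by move=> /(toric_H T)[? ?] /(toric_H T)[? ?]; rewrite (toric_wD T); lia. Qed.

Lemma good_krull_dim : (0 < strip_mult)%N -> krull_dim E 1.
Proof.
have [[ua1 wa1] [ua2 wa2]] := (toric_a1 T, toric_a2 T).
have [ub wb] := (toric_omega T b).1 bO.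
move=> m0; split.
  (* If [u b = 1] there is no line parallel to [a1], and the face along [a2] is used instead. *)
  have [ub1|ub1] : 1 < u b \/ u b = 1 by lia.
    have [u1 w1] := pP (ltn0Sn 0).
    apply: (krull_chain1 K omega_sub uD (a := a1) (c := p 1%N)) => //.
    - by rewrite ua1.
    - by apply/(toric_omega T); lia.
    - by move=> h Hh uh /(toric_in_translate T); rewrite (toric_uD T); lia.
  have wb1 : 1 < w b by move: m0; rewrite /strip_mult; lia.
  have [u1 w1] := qP (ltn0Sn 0).
  apply: (krull_chain1 K omega_sub wD (a := a2) (c := q 1%N)) => //.
  - by rewrite wa2.
  - by apply/(toric_omega T); lia.
  - by move=> h Hh uh /(toric_in_translate T); rewrite (toric_wD T); lia.
move=> k [pr [annp pch]].
apply: (krull_le1 omega_sub uD wD (N := (`|u b| + `|w b|)%N) Ha1 a1_neq0 _ Ha2 a2_neq0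
  _ _ _ _ annp pch).
- by move=> h Hh uh; apply: (toric_ray T Hh); lia.
- by move=> h Hh uh; apply: (toric_ray T' Hh); lia.
(* As [u h >= 1], the multiple by [d] has [u] at least [d = u a2]. *)
- move=> h /(toric_H T)[uh wh] uh0; exists `|d|%N.
  have [||g Hg gE] := toric_subH T (c := (h *+ `|d|)%MM) (g := a2).
  + by rewrite (toric_uMn T); nia.
  + by rewrite (toric_wMn T); nia.
  by exists g; rewrite addmC.
- move=> h /(toric_H T)[uh wh] uh0; exists `|d|%N.
  have [||g Hg gE] := toric_subH T (c := (h *+ `|d|)%MM) (g := a1).
  + by rewrite (toric_uMn T); nia.
  + by rewrite (toric_wMn T); nia.
  by exists g; rewrite addmC.
apply/(toric_in_translate T); rewrite (toric_uD T) (toric_wD T) !(toric_uMn T) !(toric_wMn T).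
by rewrite ua1 wa1 ua2 wa2; split; nia.
Qed.

Lemma good_depth : (0 < strip_mult)%N -> depth mmax E 1.
Proof.
have [[ua1 wa1] [ua2 wa2]] := (toric_a1 T, toric_a2 T).
have [ub wb] := (toric_omega T b).1 bO.
move=> m0; apply: depth_eq1; last first.
  move=> f g _ _; apply: (depth_le1 omega_sub (A := levels 0) (e0 := strip_mult)).
  - exact: levels_uniq0.
  - by move=> M; rewrite size_levels.
  - by move=> M; exact: (levels_outside T pP qP bO).
  - move=> M N MN c /levelsP[u0 w0 lev]; apply/levelsP; split=> //.
    have : M%:Z * d <= N%:Z * d by rewrite ler_pM2r //; lia.
    lia.
  - move=> c /(toric_outside T)[u0 w0 ob]; exists (`|u c| + `|w c|)%N; apply/levelsP.
    by split=> //; nia.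
  move=> h /(toric_H T)[uh wh]; exists (`|u h| + `|w h|)%N => M c /levelsP[u0 w0 lev].
  have [ib|nib] := pselect (in_translate H b (h + c)%MM); [by right|left].
  have : ~ (u b <= u (h + c)%MM /\ w b <= w (h + c)%MM) by move/(toric_in_translate T).
  have [E1 E2] := (toric_uD T h c, toric_wD T h c); rewrite E1 E2 => ob.
  have M0 : 0 < M%:Z by rewrite -(pmulr_lgt0 _ d0); lia.
  (* When the bounds for [c] and for [h + c] refer to different strips, [u b <= d <= M d] or its
     counterpart for [w b] supplies the estimate. *)
  have Md : d <= M%:Z * d by apply: ler_peMl; lia.
  have PD : (M + (`|u h| + `|w h|))%N%:Z * d = M%:Z * d + (u h + w h) * d.
    by rewrite !PoszD !gez0_abs //; ring.
  have [uhd whd] : u h <= u h * d /\ w h <= w h * d by nia.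
  by apply/levelsP; rewrite E1 E2 PD; split; lia.
have Xm a : H a -> a != 0%MM -> mmax (to_ring H 'X_[a]) by exact: max_idealX.
(* Each summand alone kills the far points of the strip along the other ray; the sum is a
   nonzerodivisor. *)
pose f : KH := to_ring H 'X_[a1] + to_ring H 'X_[a2].
have fm : mmax f.
  apply/max_idealP; rewrite /f mcoeff_msupp; rewrite -[sr_poly _]/(sr_poly (to_ring H 'X_[a1]) + sr_poly (to_ring H 'X_[a2])).
  by rewrite !sr_polyX // mcoeffD !mcoeffX (negPf a1_neq0) (negPf a2_neq0) addr0 eqxx.
exists f; split=> //.
  move=> x fx; apply: qcoef_ext => c oc; have [Oc cb] := oc; rewrite qcoef0 //.
  move/(toric_outside T): oc => [u0 w0 [uc|wc]].
    have cb1 : ~ in_translate H b (a1 + c)%MM by move/(toric_in_translate T); rewrite (toric_uD T); lia.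
    have := congr1 (qcoef (a1 + c)%MM) fx; rewrite /f scalerDl qcoefD // qcoef0 //.
    (* The other summand does not reach this exponent: [a1 + c = a2 + c'] would give
       [u c > d >= u b]. *)
    rewrite qcoefXD // (@qcoefX0 R K 2 H b a2) ?addr0 // => c' /(toric_omega T)[uc' wc'].
    by move/(congr1 u); rewrite !(toric_uD T); lia.
  have cb1 : ~ in_translate H b (a2 + c)%MM by move/(toric_in_translate T); rewrite (toric_wD T); lia.
  have := congr1 (qcoef (a2 + c)%MM) fx; rewrite /f scalerDl qcoefD // qcoef0 //.
  rewrite [X in _ + X]qcoefXD // (@qcoefX0 R K 2 H b a1) ?add0r // => c' /(toric_omega T)[uc' wc'].
  by move/(congr1 w); rewrite !(toric_wD T); lia.
have [g gl] : exists g, g \in levels 0 1.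
  have : (0 < size (levels 0 1))%N by rewrite size_levels muln1.
  by case: (levels 0 1) => // g s _; exists g; rewrite mem_head.
have og := levels_outside T pP qP bO gl; have [Og gb] := og.
exists (to_quot R H b 'X_[g]) => v /(congr1 (qcoef g)).
rewrite (qcoef_to_quotX K omega_sub Og gb) eqxx (qcoefM_minimal _ _ og (gen_minimal gl)).
move/max_idealP: fm; rewrite -mcoeff_eq0 => /eqP ->; rewrite mul0r => /eqP.
by rewrite oner_eq0.
Qed.

Lemma good_ulrich : ulrich mmax E.
Proof.
have [ub wb] := (toric_omega T b).1 bO.
have [m0|m0] := posnP strip_mult.
  (* Here [u b = w b = 1], so no exponent is left outside [b + H] and the quotient is zero. *)
  left => x; apply: qcoef_ext => c /(toric_outside T)[u0 w0]; move: m0; rewrite /strip_mult; lia.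
right; split; first by exists 1%N; [exact: good_krull_dim|exact: good_depth].
exists strip_mult; first exact: good_min_num_gens.
have cn : strip_mult%:R != 0 :> rat by rewrite pnatr_eq0 -lt0n.
(* The shift by 1 is that of m^(k+1) in the Hilbert-Samuel function. *)
exists 1%N, (strip_mult%:R *: ('X + 1%:P)); split.
- exact: good_krull_dim.
- by rewrite size_scale // size_XaddC.
- by rewrite lead_coefZ lead_coefXaddC !mulr1.
exists 0%N => k _; exists (strip_mult * k.+1)%N; first exact: good_length.
by rewrite !hornerE natrM -natr1.
Qed.

End Good.

(** * Congruences *)

Section Arithmetic.
Import Order.TTheory GRing.Theory Num.Theory.
Local Open Scope ring_scope.

Section Chains.
Variables (R : realType) (H : submonoid 2) (u w : 'X_{1..2} -> int)
  (a1 a2 : 'X_{1..2}) (d : int) (e : 'X_{1..2}) (p q : nat -> 'X_{1..2}).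
Local Notation Om := (semigroup_omega R H).
Hypothesis T : toric R H u w a1 a2 d.
Hypothesis pP : forall j, (0 < j)%N -> u (p j) = j /\ 0 < w (p j) <= d.
Hypothesis qP : forall j, (0 < j)%N -> w (q j) = j /\ 0 < u (q j) <= d.
Hypothesis eO : Om e.
Let T' := toric_sym T.

(** The given points lie on the segment from [e] to [a1], where [w] goes up by [delta] per line and
    ends at [d]. Their [w] is strictly between 0 and [d], so by congruence modulo [d] they have the
    [w] of [p j]. *)
Lemma strip_decreasing (delta : int) : 0 < delta -> w e + u e * delta = d ->
    (forall j : int, 0 < j < u e -> exists c, u c = j /\ w c = w e + (u e - j) * delta) ->
  forall i j, (0 < i < j)%N -> (j < `|u e|)%N -> w (p j) < w (p i).
Proof.
have [ue we] := (toric_omega T e).1 eO; have d0 := toric_d T.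
move=> delta0 dE pts.
have wp (j : nat) : (0 < j)%N -> (j < `|u e|)%N -> w (p j) = w e + (u e - j%:Z) * delta.
  move=> j0 je; have [|c [uc wc]] := pts j; first by lia.
  have [uj wj] := pP j0; rewrite -wc.
  have [|k kE] := toric_mod1 T (g := c) (h := p j); first by rewrite uc.
  have cd : 0 < w c < d by rewrite wc; nia.
  have : k = 0; last by move=> k0; move: kE; rewrite k0; lia.
  have : k < 1 by rewrite -(ltr_pM2r d0); lia.
  have : -1 < k by rewrite -(ltr_pM2r d0); lia.
  lia.
by move=> i j ij je; rewrite !wp; [nia|lia..].
Qed.

Hypothesis emin : forall h c, H h -> Om c -> e = (h + c)%MM -> h = 0%MM.

Lemma minimal_level : e = p `|u e|%N.
Proof.
have [ue we] := (toric_omega T e).1 eO; have d0 := toric_d T.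
have [ua wa] := toric_a1 T.
have j0 : (0 < `|u e|)%N by lia.
have [|n eE] := strip_level T pP j0 _ we; first by lia.
have Ha1 : H a1 by apply/(toric_H T); lia.
have an0 : (a1 *+ n)%MM = 0%MM.
  apply: (emin (submonoidMn n Ha1) (c := p `|u e|%N)); last by rewrite addmC.
  by have := pP j0; rewrite (toric_omega T); lia.
by rewrite {1}eE an0 addm0.
Qed.

(** This is the collinearity of the [p j] with [a1], evaluated at [e] and written without
    subtraction. *)
Lemma minimal_multiple :
    (forall i j, (0 < i < j)%N -> (j < `|u e|)%N -> w (p j) < w (p i)) ->
  exists g, (e + a1 *+ `|u e|.-1)%MM = (g *+ `|u e|)%MM.
Proof.
have [ue we] := (toric_omega T e).1 eO; have d0 := toric_d T.
have [ua wa] := toric_a1 T => dec.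
(* The hypothesis stops short of [j = u e]; there minimality of [e] takes over, as [w (p i) <= w e]
   would put [e] in [p i + H]. *)
have dec' i j : (0 < i < j)%N -> (j <= `|u e|)%N -> w (p j) < w (p i).
  move=> ij; rewrite leq_eqVlt => /predU1P[jE|]; last exact: dec.
  rewrite jE -minimal_level ltNge; apply/negP => wi.
  have i0 : (0 < i)%N by lia.
  have [ui wi'] := pP i0.
  have [||h Hh eE] := toric_subH T (c := e) (g := p i); [lia|lia|].
  have Oi : Om (p i) by apply/(toric_omega T); lia.
  have h0 := emin Hh Oi eE; move: eE; rewrite h0 add0m => eE.
  by move: ui; rewrite -eE; lia.
exists (p 1%N).
suff step k : (k < `|u e|)%N -> (p k.+1 + a1 *+ k = p 1%N *+ k.+1)%MM.
  have := step `|u e|.-1; rewrite prednK; last by lia.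
  by rewrite -minimal_level; apply.
elim: k => [|k IH] ke; first by rewrite mulm0n mulm1n addm0.
have [[u1 w1] [uk wk] [uk' wk']] := And3 (pP (ltn0Sn 0)) (pP (ltn0Sn k)) (pP (ltn0Sn k.+1)).
have [|z zE] := toric_mod1 T (g := (p k.+1 + p 1%N)%MM) (h := p k.+2).
  by rewrite (toric_uD T); lia.
have ww : w (p k.+2) < w (p k.+1) by apply: dec'; lia.
rewrite (toric_wD T) in zE.
(* The multiple [z * d] is positive because the sequence decreases, and below [2 * d] because each
   [w (p j)] lies in ]0, d]. *)
have z1 : z = 1.
  have : z < 2 by rewrite -(ltr_pM2r d0); lia.
  have : 0 < z by rewrite -(ltr_pM2r d0); lia.
  lia.
have sE : (p k.+2 + a1 = p k.+1 + p 1%N)%MM.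
  apply: (toric_inj T); rewrite ?(toric_uD T) ?(toric_wD T) ?ua ?wa; first by lia.
  by rewrite z1 in zE; lia.
rewrite [in RHS]mulmSr -IH; last by lia.
by rewrite mulmS addmA sE -addmA [(p 1%N + _)%MM]addmC addmA.
Qed.

End Chains.

Section Minimal.
Variables (R : realType) (H : submonoid 2) (u w : 'X_{1..2} -> int)
  (a1 a2 : 'X_{1..2}) (d : int) (e b : 'X_{1..2}) (p q : nat -> 'X_{1..2}).
Local Notation Om := (semigroup_omega R H).
Hypothesis T : toric R H u w a1 a2 d.
Hypothesis pP : forall j, (0 < j)%N -> u (p j) = j /\ 0 < w (p j) <= d.
Hypothesis qP : forall j, (0 < j)%N -> w (q j) = j /\ 0 < u (q j) <= d.
Hypotheses (eO : Om e) (bO : Om b).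
Hypothesis emin : forall h c, H h -> Om c -> e = (h + c)%MM -> h = 0%MM.
Hypothesis esep : forall c, Om c -> u c < u e -> w e + 2 <= w c.
Hypothesis pdec : forall i j, (0 < i < j)%N -> (j < `|u b|)%N -> w (p j) < w (p i).
Hypothesis qdec : forall i j, (0 < i < j)%N -> (j < `|w b|)%N -> u (q j) < u (q i).

(** If [u b < u e], then [w b >= w e + 2], so the [q j] decrease up to index [w e + 1]. Since [q] at
    [w e] is [e], the next point has smaller [u] than [e] but [w] larger by only 1, against
    [esep]. *)
Lemma decreasing_multiple : exists g, (e + a1 *+ `|u e|.-1)%MM = (g *+ `|u e|)%MM.
Proof.
have [[ue we] [ub wb]] := ((toric_omega T e).1 eO, (toric_omega T b).1 bO).
have [eb|be] := lerP (u e) (u b).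
  apply: (minimal_multiple T pP eO emin) => i j ij je; apply: pdec => //; lia.
exfalso; have wbe := esep bO be.
have eq := minimal_level (toric_sym T) qP eO emin.
have uq : u (q `|w e|.+1) < u (q `|w e|%N) by apply: qdec; lia.
rewrite -eq in uq.
have [wq uq'] := qP (ltn0Sn `|w e|).
have Oq : Om (q `|w e|.+1) by apply/(toric_omega T); lia.
by have := esep Oq uq; rewrite wq; lia.
Qed.

End Minimal.

Lemma coprime_proportional (x y : nat) (X Y : int) : (0 < x)%N -> coprime x y ->
  x%:Z * Y = y%:Z * X -> exists k, X = x%:Z * k /\ Y = y%:Z * k.
Proof.
move=> x0 xy E.
have : (x%:Z %| X)%Z.
  by rewrite -(@Gauss_dvdzr x%:Z y%:Z) -?E ?dvdz_mulr // coprimezE.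
move=> /dvdzP[k XE]; exists k; split; first by rewrite XE mulrC.
by apply: (@mulfI _ x%:Z); [lia|rewrite E XE; ring].
Qed.

(** A Bezout solution is shifted along [(x, y)] until the second form lies in ]0, d]. Its
    coordinates are then nonnegative, being 1/d times nonnegative combinations of the values of the
    two forms. *)
Lemma lattice_level (x y x' y' : nat) (d : int) (j : nat) :
    (0 < x)%N -> (0 < y)%N -> (0 < x')%N -> (0 < y')%N -> coprime x y ->
    d = x%:Z * y'%:Z - x'%:Z * y%:Z -> 0 < d -> (0 < j)%N ->
  exists X Y : nat, x%:Z * Y%:Z - y%:Z * X%:Z = j%:Z /\
    0 < y'%:Z * X%:Z - x'%:Z * Y%:Z <= d.
Proof.
move=> x0 y0 x'0 y'0 /eqP xy dE d0 j0.
have [s [t st]] : exists s t : int, x%:Z * s - y%:Z * t = 1.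
  case: (egcdnP y x0) => s t; rewrite xy => st _.
  by exists s, t; lia.
pose w0 := y'%:Z * (j%:Z * t) - x'%:Z * (j%:Z * s).
(* The shift by 1 turns the remainder range [0, d[ into ]0, d]. *)
pose k := ((w0 - 1) %/ d)%Z.
have wE := divz_eq (w0 - 1) d; rewrite -/k in wE.
have m0 := modz_ge0 (w0 - 1) (lt0r_neq0 d0); have m1 := ltz_pmod (w0 - 1) d0.
pose X := j%:Z * t - k * x%:Z; pose Y := j%:Z * s - k * y%:Z.
have uE : x%:Z * Y - y%:Z * X = j%:Z.
  transitivity (j%:Z * (x%:Z * s - y%:Z * t)); first by rewrite /X /Y; ring.
  by rewrite st mulr1.
have wE' : y'%:Z * X - x'%:Z * Y = w0 - k * d by rewrite /X /Y /w0 dE; ring.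
have wb : 0 < w0 - k * d <= d by lia.
have dX : d * X = x%:Z * (w0 - k * d) + x'%:Z * j%:Z by rewrite -uE -wE' dE; ring.
have dY : d * Y = y%:Z * (w0 - k * d) + y'%:Z * j%:Z by rewrite -uE -wE' dE; ring.
have wd0 : 0 <= w0 - k * d by case/andP: wb => /ltW.
have X0 : 0 <= X by rewrite -(pmulr_rge0 _ d0) dX addr_ge0 // mulr_ge0.
have Y0 : 0 <= Y by rewrite -(pmulr_rge0 _ d0) dY addr_ge0 // mulr_ge0.
by exists `|X|%N, `|Y|%N; rewrite !gez0_abs // uE wE'.
Qed.

Lemma mnm2P (g h : 'X_{1..2}) : g ord0 = h ord0 -> g ord_max = h ord_max -> g = h.
Proof. by move=> e0 e1; apply/mnmP => i; case: (ord2P i) => ->. Qed.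

(** * The determinant forms of a plane semigroup and the two congruences *)

Section Plane.
Variables (R : realType) (H : submonoid 2) (x1 y1 x2 y2 : nat).
Hypotheses (HN2 : normal_affine_semigroup R H)
  (Ha1 : extremal_ray R H (mnm2 x1 y1)) (Ha2 : extremal_ray R H (mnm2 x2 y2))
  (x1_gt0 : (0 < x1)%N) (y1_gt0 : (0 < y1)%N) (x2_gt0 : (0 < x2)%N) (y2_gt0 : (0 < y2)%N)
  (det_gt0 : (x2 * y1 < x1 * y2)%N).

Definition det1 (h : 'X_{1..2}) : int := x1%:Z * (h ord_max)%:Z - y1%:Z * (h ord0)%:Z.
Definition det2 (h : 'X_{1..2}) : int := y2%:Z * (h ord0)%:Z - x2%:Z * (h ord_max)%:Z.
Local Notation det := (x1%:Z * y2%:Z - x2%:Z * y1%:Z).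

Lemma extremal_coprime x y : extremal_ray R H (mnm2 x y) -> coprime x y.
Proof.
by case=> _ + _; rewrite !big_ord_recl big_ord0 gcdn0 /coprime => /eqP.
Qed.

Let omP := omegaP Ha1 Ha2 x1_gt0 y1_gt0 x2_gt0 y2_gt0 det_gt0.

Lemma plane_toric : toric R H det1 det2 (mnm2 x1 y1) (mnm2 x2 y2) det.
Proof.
have d0 : 0 < det by lia.
have c0E (h : 'X_{1..2}) : det * (h ord0)%:Z = x1%:Z * det2 h + x2%:Z * det1 h.
  by rewrite /det1 /det2; ring.
have c1E (h : 'X_{1..2}) : det * (h ord_max)%:Z = y1%:Z * det2 h + y2%:Z * det1 h.
  by rewrite /det1 /det2; ring.
split=> //.
- by move=> g h; rewrite /det1 !mnmDE; lia.
- by move=> g h; rewrite /det2 !mnmDE; lia.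
- move=> g h e1 e2; have := c0E g; have := c1E g; rewrite e1 e2 -c0E -c1E.
  by move=> /mulfI g1 /mulfI g0; apply: mnm2P; [have := g0|have := g1]; lia.
- move=> c g e1 e2; exists (c - g)%MM; rewrite submK //; apply/mnm_lepP => i.
  have le0 : det * (g ord0)%:Z <= det * (c ord0)%:Z by rewrite !c0E; nia.
  have le1 : det * (g ord_max)%:Z <= det * (c ord_max)%:Z by rewrite !c1E; nia.
  by rewrite !ler_pM2l // in le0 le1; case: (ord2P i) => ->.
- move=> h; rewrite (semigroupP Ha1 Ha2 x1_gt0 x2_gt0 det_gt0 HN2).
  by rewrite /det1 /det2; lia.
- by move=> h; rewrite omP /det1 /det2; lia.
- by rewrite /det1 /det2 !mnm2_0 !mnm2_1; split; ring.
- by rewrite /det1 /det2 !mnm2_0 !mnm2_1; split; ring.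
- move=> g h e1.
  have [|k [k0 k1]] := @coprime_proportional x1 y1 ((g ord0)%:Z - (h ord0)%:Z)
    ((g ord_max)%:Z - (h ord_max)%:Z) x1_gt0 (extremal_coprime Ha1).
    by move: e1; rewrite /det1; lia.
  exists k; transitivity (y2%:Z * ((g ord0)%:Z - (h ord0)%:Z)
    - x2%:Z * ((g ord_max)%:Z - (h ord_max)%:Z)); first by rewrite /det2; ring.
  by rewrite k0 k1; ring.
- move=> g h e1.
  have [|k [k0 k1]] := @coprime_proportional x2 y2 ((g ord0)%:Z - (h ord0)%:Z)
    ((g ord_max)%:Z - (h ord_max)%:Z) x2_gt0 (extremal_coprime Ha2).
    by move: e1; rewrite /det2; lia.
  exists k; transitivity (x1%:Z * ((g ord_max)%:Z - (h ord_max)%:Z)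
    - y1%:Z * ((g ord0)%:Z - (h ord0)%:Z)); first by rewrite /det1; ring.
  by rewrite k0 k1; ring.
- move=> j j0; have [X [Y [uE wE]]] := lattice_level x1_gt0 y1_gt0 x2_gt0 y2_gt0
    (extremal_coprime Ha1) erefl d0 j0.
  by exists (mnm2 X Y); rewrite /det1 /det2 !mnm2_0 !mnm2_1.
move=> j j0; have cop : coprime y2 x2 by rewrite coprime_sym; exact: extremal_coprime.
have [|Y [X [wE uE]]] := lattice_level y2_gt0 x2_gt0 y1_gt0 x1_gt0 cop _ d0 j0.
  by ring.
by exists (mnm2 X Y); rewrite /det1 /det2 !mnm2_0 !mnm2_1.
Qed.

Hypothesis H11 : semigroup_omega R H (mnm2 1 1).

Let T := plane_toric.
Let e := mnm2 1 1.

Let slopes : (y1 < x1)%N /\ (x2 < y2)%N.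
Proof. by have := (omP e).1 H11; rewrite /e !mnm2_0 !mnm2_1; lia. Qed.

Let det1e : det1 e = x1%:Z - y1%:Z.
Proof. by rewrite /det1 /e !mnm2_0 !mnm2_1; lia. Qed.
Let det2e : det2 e = y2%:Z - x2%:Z.
Proof. by rewrite /det2 /e !mnm2_0 !mnm2_1; lia. Qed.

Let omega_pos c : semigroup_omega R H c -> (0 < c ord0)%N /\ (0 < c ord_max)%N.
Proof. by move/omP => [l1 l2]; split; rewrite lt0n; apply/eqP => z; rewrite z in l1 l2; nia. Qed.

Let e_minimal h c : H h -> semigroup_omega R H c -> e = (h + c)%MM -> h = 0%MM.
Proof.
move=> _ /omega_pos[c0 c1] eE; apply: mnm2P; rewrite mnm0E.
  by have := congr1 (fun m : 'X_{1..2} => m ord0) eE; rewrite mnmDE mnm2_0; lia.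
by have := congr1 (fun m : 'X_{1..2} => m ord_max) eE; rewrite mnmDE mnm2_1; lia.
Qed.

(** The hypothesis forces [c = (i, j)] below the diagonal, [i > j >= 1]. Then
    [det2 c >= (y2 - x2) + y2], and [y2 > x2 >= 1] gives [y2 >= 2]. *)
Let sep1 c : semigroup_omega R H c -> det1 c < det1 e -> det2 e + 2 <= det2 c.
Proof.
move=> /omega_pos[c0 c1]; rewrite det1e det2e /det1 /det2; have [s1 s2] := slopes.
move: (c ord0) (c ord_max) c0 c1 => i j i0 j0 lt.
have ij : (j < i)%N by nia.
nia.
Qed.

Let sep2 c : semigroup_omega R H c -> det2 c < det2 e -> det1 e + 2 <= det1 c.
Proof.
move=> /omega_pos[c0 c1]; rewrite det1e det2e /det1 /det2; have [s1 s2] := slopes.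
move: (c ord0) (c ord_max) c0 c1 => i j i0 j0 lt.
have ij : (i < j)%N by nia.
nia.
Qed.

Lemma plane_almost_gorenstein (K : fieldType) :
  almost_gorenstein R K H <->
  (x1%:Z = 1 %[mod x1%:Z - y1%:Z])%Z /\ (x2%:Z = 1 %[mod x2%:Z - y2%:Z])%Z.
Proof.
have [s1 s2] := slopes.
have /choice[p pP] (j : nat) : exists c : 'X_{1..2},
    (0 < j)%N -> det1 c = j%:Z /\ 0 < det2 c <= det.
  by case: (posnP j) => [->|/(toric_level1 T)[c cE]]; [exists e|exists c].
have /choice[q qP] (j : nat) : exists c : 'X_{1..2},
    (0 < j)%N -> det2 c = j%:Z /\ 0 < det1 c <= det.
  by case: (posnP j) => [->|/(toric_level2 T)[c cE]]; [exists e|exists c].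
split=> [[b [bO bU]]|[m1 m2]].
  have pdec := ulrich_decreasing T pP qP bO bU.
  have qdec : forall i j, (0 < i < j)%N -> (j < `|det2 b|)%N -> det1 (q j) < det1 (q i).
    by move=> i j; exact: (ulrich_decreasing (toric_sym T) qP pP bO bU).
  have [g1 g1E] := decreasing_multiple T pP qP H11 bO e_minimal sep1 pdec qdec.
  have [g2 g2E] := decreasing_multiple (toric_sym T) qP pP H11 bO e_minimal sep2 qdec pdec.
  (* With [A = x1 - y1], first coordinates read [1 + x1 (A - 1) = g A], that is,
     [x1 - 1 = (x1 - g) A]; likewise for the second ray, up to the sign of [x2 - y2]. *)
  move: (congr1 (fun m : 'X_{1..2} => m ord0) g1E) (congr1 (fun m : 'X_{1..2} => m ord0) g2E).
  rewrite !mnmDE !mulmnE !mnm2_0 det1e det2e => E1 E2.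
  split; apply/eqP; rewrite eqz_mod_dvd; apply/dvdzP.
    by exists (x1%:Z - (g1 ord0)%:Z); nia.
  by exists ((g2 ord0)%:Z - x2%:Z); nia.
move/eqP: m1; rewrite eqz_mod_dvd => /dvdzP[t tE].
move/eqP: m2; rewrite eqz_mod_dvd => /dvdzP[s' sE].
(* The sign is changed because [x2 - y2] is negative. *)
pose s := - s'.
have s0 : 0 <= s by rewrite /s; nia.
have t1 : 1 <= t by nia.
exists e; split=> //.
have [A AE] : exists A, A = x1%:Z - y1%:Z by eexists.
have [B BE] : exists B, B = y2%:Z - x2%:Z by eexists.
have [e1A e2B] : det1 e = A /\ det2 e = B by rewrite det1e det2e AE BE.
rewrite -AE in tE.
have X1 : x1%:Z = 1 + t * A by lia.
have Y1 : y1%:Z = 1 + (t - 1) * A by lia.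
have X2 : x2%:Z = 1 + s * B by rewrite /s BE; lia.
have Y2 : y2%:Z = 1 + (s + 1) * B by lia.
(* Now [a1 = e + A (t, t - 1)] and [a2 = e + B (s, s + 1)]. A step [(t, t - 1)] lowers [det1] by 1
   and raises [det2] by [delta1]; a step [(s, s + 1)] lowers [det2] by 1 and raises [det1] by
   [delta2]. *)
pose delta1 := y2%:Z * t - x2%:Z * (t - 1).
pose delta2 := x1%:Z * (s + 1) - y1%:Z * s.
have [A0 B0] : 0 < A /\ 0 < B by lia.
have delta1_gt0 : 0 < delta1.
  have -> : delta1 = t * B + x2%:Z by rewrite /delta1 BE; ring.
  by apply: ltr_wpDl; [apply: mulr_ge0; lia|lia].
have delta2_gt0 : 0 < delta2.
  have -> : delta2 = s * A + x1%:Z by rewrite /delta2 AE; ring.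
  by apply: ltr_wpDl; [apply: mulr_ge0; lia|lia].
have d1E : det2 e + det1 e * delta1 = det by rewrite e1A e2B BE /delta1 X1 Y1; ring.
have d2E : det1 e + det2 e * delta2 = det by rewrite e1A e2B AE /delta2 X2 Y2; ring.
apply: (good_ulrich K T pP qP (b := e) H11).
- by move=> c Oc /(sep1 Oc) le lt; move: (le_lt_trans le lt); rewrite gtrDl.
- apply: (strip_decreasing T pP H11 delta1_gt0 d1E) => j; rewrite e1A e2B => jA.
  exists (mnm2 (absz (1 + (A - j) * t)) (absz (1 + (A - j) * (t - 1)))).
  rewrite /det1 /det2 !mnm2_0 !mnm2_1 !gez0_abs;
    [|by apply: addr_ge0 => //; apply: mulr_ge0; lia..].
  by split; [rewrite X1 Y1|rewrite BE /delta1]; ring.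
- apply: (strip_decreasing (toric_sym T) qP H11 delta2_gt0 d2E) => j; rewrite e1A e2B => jB.
  exists (mnm2 (absz (1 + (B - j) * s)) (absz (1 + (B - j) * (s + 1)))).
  rewrite /det1 /det2 !mnm2_0 !mnm2_1 !gez0_abs;
    [|by apply: addr_ge0 => //; apply: mulr_ge0; lia..].
  by split; [rewrite X2 Y2|rewrite AE /delta2]; ring.
- by rewrite -d1E e1A e2B -[X in X <= _]add0r; apply: lerD; [lia|apply: ler_peMr; lia].
- by rewrite -d2E e1A e2B -[X in X <= _]add0r; apply: lerD; [lia|apply: ler_peMr; lia].
Qed.

End Plane.
End Arithmetic.

Theorem corollary6p4 (R : realType) (K : fieldType) (H : submonoid 2)
    (x1 y1 x2 y2 : nat)
    (HN2 : normal_affine_semigroup R H)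
    (Ha1 : extremal_ray R H (mnm2 x1 y1))
    (Ha2 : extremal_ray R H (mnm2 x2 y2))
    (Ha12 : mnm2 x1 y1 <> mnm2 x2 y2)
    (H11 : semigroup_omega R H (mnm2 1 1))
    (Hxy : x1 * x2 * y1 * y2 <> 0) :
  almost_gorenstein R K H <->
  (x1%:Z = 1 %[mod x1%:Z - y1%:Z])%Z /\ (x2%:Z = 1 %[mod x2%:Z - y2%:Z])%Z.
Proof.
have [x1_gt0 y1_gt0 x2_gt0 y2_gt0] : [/\ 0 < x1, 0 < y1, 0 < x2 & 0 < y2].
  by move/eqP: Hxy; rewrite !muln_eq0 !negb_or !lt0n => /andP[/andP[/andP[-> ->] ->] ->].
have [lt|lt|det0] := ltngtP (x2 * y1) (x1 * y2).
- exact: (plane_almost_gorenstein HN2 Ha1 Ha2).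
- rewrite (plane_almost_gorenstein HN2 Ha2 Ha1) //.
  by rewrite and_comm.
(* With determinant zero, two primitive vectors with positive coordinates coincide. *)
have [c1 c2] := (extremal_coprime Ha1, extremal_coprime Ha2).
have x12 : x1 %| x2.
  by rewrite -(Gauss_dvdl x2 c1) det0 dvdn_mulr.
have x21 : x2 %| x1.
  by rewrite -(Gauss_dvdl x1 c2) -det0 dvdn_mulr.
have /eqP xE : x1 == x2 by rewrite eqn_dvd x12.
case: Ha12; congr (mnm2 _ _) => //; apply/eqP.
by rewrite -(eqn_pmul2l x2_gt0) det0 xE.
Qed.
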